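(* Let $\Omega$ be a bounded domain in $\mathbb{R}^n$, let $f$ satisfy the standing assumptions, $p\geq1$, and $\nu\in\mathcal{P}(\Omega)$. Then there exists a unique $\mu\in\mathcal{P}(\Omega)$ minimizing $\mathfrak{F}^p_\nu$ over $\mathcal{P}(\Omega)$; it is absolutely continuous, $\mu=u\cdot\mathcal{L}^n$, and there exists a Kantorovich potential $\psi$ for the transport between $\mu$ and $\nu$ with cost $c(x,y)=|x-y|^p$ such that $-\psi\geq0$ a.e. and $u=k(-\psi)$ a.e. in $\Omega$, where $k=(f')^{-1}$.
   Context: A bounded domain is a bounded set $\Omega\subset\mathbb{R}^n$ which is the closure of a nonempty connected open set and whose boundary is Lebesgue-negligible. $\mathcal{P}(\Omega)$ is the set of Borel probability measures on $\Omega$. Standing assumptions on $f$: $f:[0,+\infty)\to[0,+\infty)$ is strictly convex and $C^1$, $f(0)=0$, $f'(0)=0$, and $\lim_{t\to+\infty}f(t)/t=+\infty$; $k=(f')^{-1}:[0,+\infty)\to[0,+\infty)$. $T_p(\mu,\nu)=\inf_\gamma\int|x-y|^p\,d\gamma$ over transport plans $\gamma$ (probability measures on $\Omega\times\Omega$ with marginals $\mu,\nu$). $F(\mu)=\int_\Omega f(u)\,dx$ if $\mu=u\cdot\mathcal{L}^n$, $+\infty$ otherwise. $\mathfrak{F}^p_\nu(\mu)=T_p(\mu,\nu)+F(\mu)$. For $c(x,y)=|x-y|^p$, $\chi^c(y)=\inf_{x\in\Omega}(c(x,y)-\chi(x))$; $\chi$ is $c$-concave if $\chi=\phi^c$ for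 some $\phi$. A Kantorovich potential between $\mu$ and $\nu$ is a $c$-concave $\psi$ maximizing $\int\varphi\,d\mu+\int\varphi^c\,d\nu$ among $c$-concave $\varphi$. *)

(* Defs.v *)
(* R^n is modelled as [n.-tuple R]
   with its product (= Borel) sigma-algebra from MathComp-Analysis. *)
From HB Require Import structures.
From mathcomp Require Import all_boot all_order all_algebra.
From mathcomp Require Import all_classical all_reals all_analysis.
Import Order.TTheory GRing.Theory Num.Theory.
Import numFieldNormedType.Exports.
Set Implicit Arguments.
Unset Strict Implicit.
Unset Printing Implicit Defensive.
Local Open Scope classical_set_scope.
Local Open Scope ring_scope.

Section Defs.
Variable R : realType.

Fixpoint lebn (n : nat) : set (n.-tuple R) -> \bar R :=
  match n return set (n.-tuple R) -> \bar R with
  | 0 => fun A => (\1_A [tuple] : R)%:E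
  | m.+1 => fun A =>
      ((@lebesgue_measure R) \x (@lebn m))%E
        ((fun q : R * m.-tuple R => cons_tuple q.1 q.2) @^-1` A)
  end.

Definition edist (n : nat) (x y : n.-tuple R) : R :=
  Num.sqrt (\sum_(i < n) (tnth x i - tnth y i) ^+ 2).

Definition eopen n (A : set (n.-tuple R)) : Prop :=
  forall x, A x -> exists2 e : R, 0 < e & forall y, edist x y < e -> A y.

Definition einterior n (A : set (n.-tuple R)) : set (n.-tuple R) :=
  [set x | exists2 e : R, 0 < e & forall y, edist x y < e -> A y].

Definition eclosure n (A : set (n.-tuple R)) : set (n.-tuple R) :=
  [set x | forall e : R, 0 < e -> exists y, A y /\ edist x y < e].

Definition ebounded n (A : set (n.-tuple R)) : Prop :=
  exists M : R, forall x y, A x -> A y -> edist x y <= M.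

Definition econnected n (A : set (n.-tuple R)) : Prop :=
  forall U V : set (n.-tuple R), eopen U -> eopen V ->
    A `<=` U `|` V -> A `&` U `&` V = set0 ->
    A `&` U = set0 \/ A `&` V = set0.

Definition bounded_domain n (Om : set (n.-tuple R)) : Prop :=
  [/\ ebounded Om,
      exists O : set (n.-tuple R),
        [/\ eopen O, O !=set0, econnected O & Om = eclosure O]
    & @lebn n (eclosure Om `\` einterior Om) = 0%E].

Definition in_PO n (Om : set (n.-tuple R)) (mu : probability (n.-tuple R) R) : Prop :=
  mu Om = 1%E.

Definition cost n (p : R) (x y : n.-tuple R) : R := edist x y `^ p.

Definition is_plan n (mu nu : probability (n.-tuple R) R)
  (g : probability (n.-tuple R * n.-tuple R)%type R) : Prop :=
  forall A : set (n.-tuple R), measurable A ->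
    g (A `*` setT) = mu A /\ g (setT `*` A) = nu A.

Definition Tp n (p : R) (mu nu : probability (n.-tuple R) R) : \bar R :=
  ereal_inf [set (\int[g]_z (cost p z.1 z.2)%:E)%E | g in is_plan mu nu].

Definition is_density n (mu : probability (n.-tuple R) R) (u : n.-tuple R -> R) : Prop :=
  [/\ measurable_fun setT u, (forall x, 0 <= u x) &
      forall A, measurable A -> mu A = (\int[@lebn n]_(x in A) (u x)%:E)%E].

(* F(mu) = int_Omega f(u) dx if mu = u . L^n, +oo otherwise
   (the infimum over the empty set is +oo; the integral does not depend
   on the choice of the density) *)
Definition Fent n (f : R -> R) (Om : set (n.-tuple R))
  (mu : probability (n.-tuple R) R) : \bar R :=
  ereal_inf [set (\int[@lebn n]_(x in Om) (f (u x))%:E)%E | u in is_density mu].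

Definition Ffrak n (f : R -> R) (p : R) (Om : set (n.-tuple R))
  (nu mu : probability (n.-tuple R) R) : \bar R :=
  (Tp p mu nu + Fent f Om mu)%E.

Definition ctrans n (p : R) (Om : set (n.-tuple R)) (chi : n.-tuple R -> R)
  (y : n.-tuple R) : \bar R :=
  ereal_inf [set ((cost p x y)%:E - (chi x)%:E)%E | x in Om].

Definition c_concave n (p : R) (Om : set (n.-tuple R)) (chi : n.-tuple R -> R) : Prop :=
  exists phi : n.-tuple R -> R, forall y, Om y -> ctrans p Om phi y = (chi y)%:E.

Definition kant_obj n (p : R) (Om : set (n.-tuple R))
  (mu nu : probability (n.-tuple R) R) (phi : n.-tuple R -> R) : \bar R :=
  (\int[mu]_(x in Om) (phi x)%:E + \int[nu]_(y in Om) ctrans p Om phi y)%E.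

Definition kantorovich_potential n (p : R) (Om : set (n.-tuple R))
  (mu nu : probability (n.-tuple R) R) (psi : n.-tuple R -> R) : Prop :=
  c_concave p Om psi /\
  forall phi, c_concave p Om phi -> (kant_obj p Om mu nu phi <= kant_obj p Om mu nu psi)%E.

End Defs.

(* Main.v *)
(** The problem is dual to the maximization of
      D(chi) = int chi^c dnu - int_Om f^*(- chi) dx,
    where [f^*(s) = max_(t >= 0) (s t - f t)] is attained at [t = k (max s 0)].
    Restricted to functions with the modulus of continuity of the cost, [D] is
    coercive and attains its maximum, and replacing a maximizer [phi] by
    [(min phi 0)^cc] does not decrease [D]; so some c-concave [psi <= 0] is
    optimal.  The first variation of [D] at [psi] says that [u = k (- psi)] has
    mass one and that [psi] is a Kantorovich potential from [mu = u dx] to [nu].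
    Transport duality (Farkas' lemma on fine partitions, glued by plans with
    piecewise constant density with respect to [mu x nu]) then gives
    [T_p(mu, nu) = int psi dmu + int psi^c dnu], and integrating the Fenchel
    inequality [f t + psi t >= f u + psi u], strict for [t <> u], yields both
    minimality and uniqueness of [mu]. *)
Require Import Defs.
From HB Require Import structures.
From mathcomp Require Import all_boot all_order all_algebra.
From mathcomp Require Import all_classical all_reals all_analysis.
From mathcomp Require Import measurable_realfun ring lra.
Import Order.TTheory GRing.Theory Num.Theory.
Import numFieldNormedType.Exports.
Set Implicit Arguments.
Unset Strict Implicit.
Unset Printing Implicit Defensive.
Local Open Scope classical_set_scope.
Local Open Scope ring_scope.

(** * Farkas' lemma and finite transport duality *)

(** The minimizer is not sought among measures: [psi] is found first and [mu] is defined from it, so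
    the compactness behind existence is Tychonoff's theorem for bounded real functions. On the
    primal side [Tp] is an infimum, and plans of cost at most [V + e] for every [e > 0] bound it by
    [V]. The abstract sections work on a measurable space without topology. Apart from elementary
    properties (symmetry, sign, bound, zero diagonal, measurability), the cost enters only through
    [c_part]: for each [e] there is a finite measurable partition of [Om] with representatives in
    [Om], and moving [x] to the representative of its cell changes [c x y] by at most [e], uniformly
    in [y]. This makes functions of class [Lip] measurable, upgrades closeness at finitely many
    points to uniform closeness, reduces changes of variables to finite sums, and discretizes the
    transport problem. Functions of class [Lip] are bounded on [Om], so integrals of potentials are
    real numbers; extended reals remain for the entropy and the transport cost. *)

Section farkas.
Variables (R : realFieldType) (X : Type) (K : eqType).

Definition lin (A : (X -> R) -> R) : Prop :=
  forall a x y, A (fun z => a * x z + y z) = a * A x + A y.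

Lemma lin_comb (A : (X -> R) -> R) (B : (X -> R) -> R) (a : R) :
  lin A -> lin B -> lin (fun x => A x - a * B x).
Proof. by move=> lA lB t x y; rewrite lA lB; ring. Qed.

Lemma linZ (A : (X -> R) -> R) a x : lin A -> A (fun z => a * x z) = a * A x.
Proof.
move=> lA; have lA0 : A (fun=> 0) = 0.
  have := lA 1 (fun=> 0) (fun=> 0).
  have -> : (fun z : X => 1 * 0 + 0 : R) = (fun=> 0).
    by apply: funext => z; ring.
  by lra.
have := lA a x (fun=> 0); rewrite lA0 addr0 => <-; congr A.
by apply: funext => z; rewrite addr0.
Qed.

(* Bartl's induction: if the last constraint [k0] is needed, some [x0] violates
   it while satisfying the others, and projecting along [x0] onto the kernel of
   [A k0] removes it. *)
Lemma farkas (s : seq K) (A : K -> (X -> R) -> R) (b : (X -> R) -> R) :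
  uniq s -> (forall k, lin (A k)) -> lin b ->
  (forall x, (forall k, k \in s -> A k x <= 0) -> b x <= 0) ->
  exists2 l : K -> R, (forall k, 0 <= l k) &
    forall x, b x = \sum_(k <- s) l k * A k x.
Proof.
elim: s A b => [|k0 s IH] A b.
  move=> _ _ lb H; exists (fun=> 0) => // x; rewrite big_nil.
  have h1 := H x (fun k kn => ltac:(by rewrite in_nil in kn)).
  have := H (fun z => -1 * x z) (fun k kn => ltac:(by rewrite in_nil in kn)).
  by rewrite linZ // => h2; lra.
rewrite cons_uniq => /andP[k0s us] lA lb H.
have [H0|] := pselect (forall x, (forall k, k \in s -> A k x <= 0) -> b x <= 0).
  have [l l0 lE] := IH A b us lA lb H0.
  exists (fun k => if k == k0 then 0 else l k) => [k|x]; first by case: ifP.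
  rewrite big_cons eqxx mul0r add0r lE; apply: eq_big_seq => k ks.
  by case: eqP => // kk; rewrite -kk ks in k0s.
move=> /existsNP[x1 /not_implyP[Ax1 /negP]]; rewrite -ltNge => bx1.
have Ak0 : 0 < A k0 x1.
  rewrite ltNge; apply/negP => Ak0; have := H x1; rewrite leNgt bx1.
  by move=> /(_ _)/notF[]; move=> k; rewrite inE => /predU1P[->//|]; exact: Ax1.
pose x0 z := (A k0 x1)^-1 * x1 z.
have A1 : A k0 x0 = 1 by rewrite linZ // mulVf // gt_eqF.
have Ax0 k : k \in s -> A k x0 <= 0.
  by move=> ks; rewrite linZ // pmulr_rle0 ?invr_gt0// Ax1.
have bx0 : 0 < b x0 by rewrite linZ // pmulr_rgt0 ?invr_gt0.
pose A' k x := A k x - A k x0 * A k0 x.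
pose b' x := b x - b x0 * A k0 x.
have [//||||l l0 lE] := IH A' b'.
- by move=> k; apply: lin_comb.
- exact: lin_comb.
- move=> x Hx; pose z y := - A k0 x * x0 y + x y.
  have := H z; rewrite lb => h.
  suff : - A k0 x * b x0 + b x <= 0 by rewrite /b'; lra.
  apply: h => k; rewrite inE => /predU1P[->|ks]; rewrite lA ?A1; first by lra.
  by have := Hx k ks; rewrite /A'; lra.
(* Expanding [A'] and [b'] in [lE] forces this coefficient at [k0]. It is nonnegative because
   [b x0 > 0] while [A k x0 <= 0] for [k] in [s]. *)
exists (fun k => if k == k0 then b x0 - \sum_(k <- s) l k * A k x0 else l k).
  move=> k; case: ifP => // _; rewrite subr_ge0 (le_trans _ (ltW bx0))//.
  by rewrite big_seq sumr_le0// => i si; rewrite mulr_ge0_le0// Ax0.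
move=> x; rewrite big_cons eqxx.
have -> : \sum_(j <- s) (if j == k0 then b x0 - \sum_(k <- s) l k * A k x0
    else l j) * A j x = \sum_(j <- s) l j * A j x.
  apply: eq_big_seq => k ks.
  by case: eqP => // kk; rewrite -kk ks in k0s.
have := lE x; rewrite /b' /A'.
under eq_bigr do rewrite mulrBr mulrA.
by rewrite big_split/= sumrN -mulr_suml; lra.
Qed.

End farkas.

(** Farkas' lemma applied to the homogenized dual problem: the coordinate [None] is a scale
    multiplying both [C] and [V], which makes the affine constraints linear. The multipliers of the
    constraints on pairs [(i, j)] form the plan [w]. *)
Lemma transport_duality (R : realFieldType) (I : finType) (m n : I -> R)
    (C : I -> I -> R) (V : R) :
  (forall i, 0 <= m i) -> (forall i, 0 <= n i) ->
  \sum_i m i = 1 -> \sum_i n i = 1 ->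
  (forall a b : I -> R, (forall i j, a i + b j <= C i j) ->
     \sum_i a i * m i + \sum_j b j * n j <= V) ->
  exists w : I -> I -> R, [/\ forall i j, 0 <= w i j,
    forall i, \sum_j w i j = m i, forall j, \sum_i w i j = n j &
    \sum_i \sum_j w i j * C i j <= V].
Proof.
move=> m0 n0 m1 n1 HV.
pose X := option (I + I).
pose a (x : X -> R) i := x (Some (inl i)).
pose b (x : X -> R) i := x (Some (inr i)).
pose A (k : unit + I * I) (x : X -> R) := if k is inr ij
  then a x ij.1 + b x ij.2 - x None * C ij.1 ij.2 else - x None.
pose obj x := \sum_i a x i * m i + \sum_j b x j * n j - x None * V.
have sumlin (h g : I -> R) t y : \sum_i (t * h i + g i) * y i =
    t * \sum_i h i * y i + \sum_i g i * y i.
  by rewrite mulr_sumr -big_split/=; apply: eq_bigr => i _; ring.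
have [|k||x Hx|l l0 lE] := @farkas R X _ (index_enum (unit + I * I)%type) A obj.
- exact: index_enum_uniq.
- by case: k => [[]|[i j]] t x y; rewrite /A /a /b/=; ring.
- by move=> t x y; rewrite /obj /a /b !sumlin; ring.
- have t0 : 0 <= x None.
    by have := Hx (inl tt) (mem_index_enum _); rewrite /A; lra.
  have hab i j : a x i + b x j <= x None * C i j.
    by have := Hx (inr (i, j)) (mem_index_enum _); rewrite /A/=; lra.
  (* At scale 0 the constraints read [a i + b j <= 0], and the objective is their average against
     the product of [m] and [n]. At positive scale, dividing by the scale gives admissible
     potentials for [HV]. *)
  move: t0; rewrite le_eqVlt => /predU1P[t0|t0]; rewrite /obj.
    rewrite -t0 mul0r subr0.
    have -> : \sum_i a x i * m i + \sum_j b x j * n j =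
        \sum_i \sum_j m i * n j * (a x i + b x j).
      under [RHS]eq_bigr => i _.
        under eq_bigr do rewrite mulrDr.
        rewrite big_split/=.
        under eq_bigr do rewrite mulrAC.
        rewrite -mulr_sumr n1 mulr1.
        under [X in _ + X]eq_bigr do rewrite -mulrA.
        rewrite -mulr_sumr mulrC.
        over.
      rewrite big_split/= -mulr_suml m1 mul1r; congr (_ + _).
      by apply: eq_bigr => j _; rewrite mulrC.
    apply: sumr_le0 => i _; apply: sumr_le0 => j _.
    rewrite mulr_ge0_le0 ?mulr_ge0//.
    by have := hab i j; rewrite -t0 mul0r.
  have := HV (fun i => (x None)^-1 * a x i) (fun i => (x None)^-1 * b x i).
  have sc (h y : I -> R) : \sum_i (x None)^-1 * h i * y i =
      (x None)^-1 * \sum_i h i * y i.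
    by rewrite mulr_sumr; apply: eq_bigr => i _; rewrite mulrA.
  rewrite !sc -mulrDr subr_le0 => h; rewrite -ler_pdivrMl//; apply: h => i j.
  by rewrite -mulrDr ler_pdivrMl.
pose w i j := l (inr (i, j)).
have lE' x : obj x = - (l (inl tt) * x None) +
    \sum_i \sum_j w i j * (a x i + b x j - x None * C i j).
  rewrite lE big_sumType/=; congr (_ + _).
    by rewrite (bigD1 tt)//= big1 ?addr0 ?mulrN// => -[].
  by rewrite pair_big/=; apply: eq_bigr => -[i j].
have delta (h : I -> R) (i : I) : \sum_j (j == i)%:R * h j = h i.
  rewrite (bigD1 i)//= eqxx mul1r big1 ?addr0// => j /negPf ->.
  by rewrite mul0r.
have zer (h : I -> R) : \sum_i 0 * h i = 0 by rewrite big1// => i _;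
  rewrite mul0r.
(* Testing the identity [lE'] on the unit vectors of [a], of [b] and of the scale yields the two
   marginals and the cost bound; the multiplier of the sign constraint is the slack in the
   latter. *)
exists w; split => [i j|i|j|]; first exact: l0.
- have := lE' (fun z => if z is Some (inl j) then (j == i)%:R else 0).
  rewrite /obj /a /b/= delta zer mul0r subr0 mulr0 oppr0 addr0 add0r => ->.
  under [RHS]eq_bigr => i' _ do
    under eq_bigr do rewrite mul0r subr0 addr0 mulrC.
  by under [RHS]eq_bigr do rewrite -mulr_sumr; rewrite delta.
- have := lE' (fun z => if z is Some (inr i) then (i == j)%:R else 0).
  rewrite /obj /a /b/= delta zer mul0r subr0 mulr0 oppr0 !add0r => ->.
  rewrite [RHS]exchange_big/=.
  under [RHS]eq_bigr => i' _ do
    under eq_bigr do rewrite mul0r subr0 add0r mulrC.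
  by under [RHS]eq_bigr do rewrite -mulr_sumr; rewrite delta.
pose e (z : X) : R := if z is None then 1 else 0.
have objE : obj e = - V.
  by rewrite /obj /a /b/= (zer m) (zer n) mul1r addr0 sub0r.
have sE : \sum_i \sum_j w i j * (a e i + b e j - e None * C i j) =
    - \sum_i \sum_j w i j * C i j.
  rewrite -sumrN; apply: eq_bigr => i _; rewrite -sumrN; apply: eq_bigr => j _.
  by rewrite /a /b/=; ring.
have := lE' e; rewrite objE sE mulr1; have := l0 (inl tt); lra.
Qed.

(** * The Legendre conjugate of [f] *)

Section conjugate.
Variables (R : realType) (f df k : R -> R).
Hypothesis f_ge0 : forall x : R, 0 <= x -> 0 <= f x.
Hypothesis f_cvx : forall x y t : R, 0 <= x -> 0 <= y -> x != y ->
  0 < t -> t < 1 -> f (t * x + (1 - t) * y) < t * f x + (1 - t) * f y.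
Hypothesis f_drv : forall x : R, 0 < x -> is_derive x 1 f (df x).
Hypothesis f0 : f 0 = 0.
Hypothesis df0 : df 0 = 0.
Hypothesis kP : forall t : R, 0 <= t -> 0 <= k t /\ df (k t) = t.
Hypothesis kK : forall x : R, 0 <= x -> k (df x) = x.

(** By convexity, the difference quotients of [f] along the segment from [a] to [t] are at most
    [f t - f a], and they converge to [df a * (t - a)]. The point [a = 0] is apart since [f_drv]
    concerns positive points; there the tangent is the zero line. *)
Lemma tangent_le (a t : R) : 0 <= a -> 0 <= t -> f a + df a * (t - a) <= f t.
Proof.
move=> a0 t0; have [->|ta] := eqVneq t a; first by rewrite subrr mulr0 addr0.
have [aE|a_neq0] := eqVneq a 0.
  by rewrite aE f0 df0 mul0r addr0 f_ge0.
have {}a0 : 0 < a by rewrite lt_def a_neq0.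
pose g (h : R) := f (h * (t - a) + a).
have g1 : is_derive (0 : R) (1 : R) g (df a * (t - a)).
  have d1 : is_derive (0 : R) (1 : R) (fun h => h * (t - a) + a) (t - a).
    have -> : (fun h : R => h * (t - a) + a) = (t - a) \*: id + cst a.
      by apply: funext => h; rewrite /= [RHS]/GRing.add/= mulrC.
    by apply: is_derive_eq; rewrite addr0 [LHS]mulr1.
  have := @is_derive1_comp _ f (fun h => h * (t - a) + a) 0 (df a) (t - a) _ d1.
  by rewrite mul0r add0r; apply; exact: f_drv.
rewrite -lerBrDl -(derive_val (is_derive := g1)).
have qc : (h^-1 *: ((g \o shift 0) (h *: 1) - g 0)) @[h --> (0 : R)^'+] -->
    ('D_1 g (0 : R) : R).
  by apply: cvg_dnbhs_at_right; exact: (@ex_derive _ _ _ _ _ _ _ g1).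
rewrite -(cvg_lim _ qc)//; apply: limr_le; first by apply/cvg_ex; eexists;
  exact: qc.
near=> h; have h0 : 0 < h by near: h; exact: nbhs_right_gt.
have h1 : h < 1 by near: h; exact: nbhs_right_lt.
rewrite /g/= /shift/= addr0 scaler1 mul0r add0r [_ *: _]mulrC ler_pdivrMr//.
have := f_cvx t0 (ltW a0) ta h0 h1.
have -> : h * t + (1 - h) * a = h * (t - a) + a by ring.
by lra.
Unshelve. all: by end_near. Qed.

(** Strictness comes from comparing the tangent with [f] at the midpoint, where convexity is
    strict. *)
Lemma tangent_lt (a t : R) : 0 <= a -> 0 <= t -> t != a ->
  f a + df a * (t - a) < f t.
Proof.
move=> a0 t0 ta; have h1 : 2^-1 < 1 :> R by lra.
have h0 : 0 < 2^-1 :> R by lra.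
have := f_cvx t0 a0 ta h0 h1.
set m := 2^-1 * t + _ => fm.
have m0 : 0 <= m by rewrite /m; lra.
have := tangent_le a0 m0.
have -> : m - a = 2^-1 * (t - a) by rewrite /m; field.
by move: fm; lra.
Qed.

Definition kp (s : R) : R := k (Num.max s 0).

Definition conj_f (s : R) : R := s * kp s - f (kp s).

Lemma kp_ge0 s : 0 <= kp s.
Proof. by apply kP; rewrite le_max lexx orbT. Qed.

Lemma kp_le0 s : s <= 0 -> kp s = 0.
Proof. by move=> s0; rewrite /kp (max_idPr s0) -df0 kK. Qed.

Lemma kp_nneg s : 0 <= s -> kp s = k s.
Proof. by move=> s0; rewrite /kp (max_idPl s0). Qed.

Lemma fenchel_lt s t : 0 <= t -> t != kp s -> s * t - f t < conj_f s.
Proof.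
move=> t0 ts; rewrite /conj_f; have [s0|s0] := leP s 0.
  have := tangent_lt (lexx 0) t0; rewrite f0 df0 mul0r addr0.
  move: ts; rewrite kp_le0// f0 mulr0 subr0 => t_neq0 /(_ t_neq0) ft.
  have : s * t <= 0 by rewrite mulr_le0_ge0.
  by lra.
have [k0 dk] := kP (ltW s0).
move: ts; rewrite kp_nneg ?ltW// => ts.
by have := tangent_lt k0 t0 ts; rewrite dk; lra.
Qed.

Lemma fenchel s t : 0 <= t -> s * t - f t <= conj_f s.
Proof.
by move=> t0; have [->//|ts] := eqVneq t (kp s); apply/ltW/fenchel_lt.
Qed.

Lemma conj_f_ge0 s : 0 <= conj_f s.
Proof. by have := fenchel s (lexx 0); rewrite f0 mulr0 subr0. Qed.

Lemma conj_f_le0 s : s <= 0 -> conj_f s = 0.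
Proof. by move=> s0; rewrite /conj_f kp_le0// mulr0 f0 subr0. Qed.

(** [kp s'] is a subgradient of [conj_f] at [s']. With the continuity of [kp], this replaces the
    derivative of the conjugate in the first variation. *)
Lemma conj_f_sub s s' : conj_f s' - conj_f s <= kp s' * (s' - s).
Proof. by have := fenchel s (kp_ge0 s'); rewrite {2}/conj_f; lra. Qed.

Lemma kp_homo : {homo kp : s s' / s <= s'}.
Proof.
move=> s s'; rewrite le_eqVlt => /predU1P[->//|ss].
have h1 := conj_f_sub s s'; have h2 := conj_f_sub s' s.
have : 0 <= (s' - s) * (kp s' - kp s) by lra.
by rewrite pmulr_rge0 ?subr_ge0// subr_gt0.
Qed.

Lemma conj_f_homo : {homo conj_f : s s' / s <= s'}.
Proof.
move=> s s' ss; have := conj_f_sub s' s.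
have : 0 <= kp s * (s' - s) by rewrite mulr_ge0 ?kp_ge0 ?subr_ge0.
by lra.
Qed.

Lemma df_ge0 x : 0 <= x -> 0 <= df x.
Proof.
rewrite le_eqVlt => /predU1P[<-|x0]; first by rewrite df0.
have := tangent_le (ltW x0) (lexx 0).
rewrite f0 sub0r => h; have := f_ge0 (ltW x0) => h1.
have : 0 <= df x * x by lra.
by rewrite pmulr_lge0.
Qed.

Lemma kp_df x : 0 <= x -> kp (df x) = x.
Proof. by move=> x0; rewrite kp_nneg ?df_ge0// kK. Qed.

(* [kp] is monotone and its range is an interval, hence it has no jump. *)
Lemma kp_continuous : continuous kp.
Proof.
move=> s; apply/cvgrPdist_le => e e0.
have ke0 : 0 <= kp s + e by rewrite addr_ge0 ?kp_ge0// ltW.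
have up : \forall t \near s, kp t <= kp s + e.
  have h : s < df (kp s + e).
    rewrite ltNge; apply/negP => /kp_homo.
    by rewrite kp_df// gerDl leNgt e0.
  near=> t; rewrite -[leRHS]kp_df//.
  by apply: kp_homo; near: t; exact: lt_le_nbhsl.
have dn : \forall t \near s, kp s - e <= kp t.
  have [h|h] := leP (kp s - e) 0.
    by near=> t; rewrite (le_trans h)// kp_ge0.
  have h' : df (kp s - e) < s.
    rewrite ltNge; apply/negP => /kp_homo.
    by rewrite kp_df ?(ltW h)// lerBrDr gerDl leNgt e0.
  near=> t; rewrite -[leLHS]kp_df ?(ltW h)//.
  by apply: kp_homo; near: t; exact: lt_le_nbhsr.
near=> t; rewrite ler_distlC; apply/andP; split; near: t => //.
Unshelve. all: by end_near. Qed.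

Lemma conj_f_lip B s s' : s <= B -> s' <= B ->
  `|conj_f s - conj_f s'| <= kp B * `|s - s'|.
Proof.
wlog ss : s s' / s <= s'.
  move=> h sB s'B; have [ss|/ltW ss] := leP s s'; first exact: h.
  by rewrite distrC (distrC s); exact: h.
move=> _ s'B; rewrite distrC (distrC s) !ger0_norm ?subr_ge0 ?conj_f_homo//.
rewrite (le_trans (conj_f_sub _ _))// ler_wpM2r ?subr_ge0//.
exact: kp_homo.
Qed.

Lemma conj_f_continuous : continuous conj_f.
Proof.
move=> s; apply/cvgrPdist_le => e e0.
have K0 : 0 < kp (s + 1) + 1 by rewrite ltr_wpDl ?kp_ge0.
near=> t; have st : `|s - t| <= 1 by near: t; exact: cvgr_dist_le.
have t1 : t <= s + 1 by move: st; rewrite ler_distlC => /andP[].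
rewrite (le_trans (@conj_f_lip (s + 1) _ _ _ _))// ?lerDl//.
rewrite (@le_trans _ _ ((kp (s + 1) + 1) * `|s - t|))//.
  by rewrite ler_wpM2r// lerDl.
rewrite -ler_pdivlMl//; near: t; apply: cvgr_dist_le => //.
by rewrite mulr_gt0// invr_gt0.
Unshelve. all: by end_near. Qed.

Lemma df_homo x y : 0 <= x -> x <= y -> df x <= df y.
Proof.
move=> x0; rewrite le_eqVlt => /predU1P[->//|xy].
have y0 : 0 <= y by rewrite (le_trans x0)// ltW.
have h1 := tangent_le x0 y0; have h2 := tangent_le y0 x0.
have : 0 <= (y - x) * (df y - df x) by lra.
by rewrite pmulr_rge0 ?subr_ge0// subr_gt0.
Qed.

Lemma f_homo x y : 0 <= x -> x <= y -> f x <= f y.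
Proof.
move=> x0 xy; have := tangent_le x0 (le_trans x0 xy).
have : 0 <= df x * (y - x) by rewrite mulr_ge0 ?df_ge0 ?subr_ge0.
by lra.
Qed.

(** Nothing is assumed about [f] on negative numbers, hence the positive part. A density is
    unchanged by it, so this gives the measurability of [f] composed with a density. *)
Lemma f_continuous : continuous (fun x : R => f (Num.max x 0)).
Proof.
move=> s; apply/cvgrPdist_le => e e0.
(* [B] dominates the positive parts of all points within 1 of [s], so [df B + 1] is a positive
   Lipschitz constant there. *)
pose B := Num.max (s + 1) 0; have B0 : 0 <= B by rewrite le_max lexx orbT.
have K0 : 0 < df B + 1 by rewrite ltr_wpDl ?df_ge0.
near=> t; have st : `|s - t| <= 1 by near: t; exact: cvgr_dist_le.
have t1 : t <= s + 1 by move: st; rewrite ler_distlC => /andP[].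
have lip x y : x <= y -> y <= s + 1 ->
    `|f (Num.max x 0) - f (Num.max y 0)| <= (df B + 1) * (y - x).
  move=> xy ys; set x' := Num.max x 0; set y' := Num.max y 0.
  have x'0 : 0 <= x' by rewrite le_max lexx orbT.
  have xy' : x' <= y' by rewrite /x' /y' ge_max !le_max xy lexx orbT.
  have yB : y' <= B by rewrite /y' /B ge_max !le_max ys lexx orbT.
  have y'0 := le_trans x'0 xy'.
  rewrite distrC ger0_norm ?subr_ge0 ?f_homo//.
  have := tangent_le y'0 x'0.
  have h : df y' * (y' - x') <= (df B + 1) * (y - x).
    rewrite ler_pM ?df_ge0 ?subr_ge0//.
      by rewrite (le_trans (df_homo y'0 yB))// lerDl.
    by rewrite /x' /y'; case: (leP y 0); case: (leP x 0) => ? ?; lra.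
  by lra.
rewrite (@le_trans _ _ ((df B + 1) * `|s - t|))//.
  have [ts|/ltW ts] := leP t s.
    by rewrite distrC (ger0_norm (_ : 0 <= s - t)) ?subr_ge0// lip// lerDl.
  by rewrite (distrC s t) (ger0_norm (_ : 0 <= t - s)) ?subr_ge0// lip.
rewrite -ler_pdivlMl//; near: t; apply: cvgr_dist_le => //.
by rewrite mulr_gt0// invr_gt0.
Unshelve. all: by end_near. Qed.

End conjugate.

(** * Bounded measurable functions and c-transforms *)

Section bounded_measurable.
Context {d : measure_display} {T : measurableType d} {R : realType}.
Variable Om : set T.
Hypothesis mOm : measurable Om.
Implicit Types (h g : T -> R).

(** Such functions are integrable for every finite measure and stable under the algebraic
    operations, so linearity and monotonicity of real integrals need no separate integrability
    argument. *)
Definition bmf h := measurable_fun Om h /\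
  exists B, forall x, Om x -> `|h x| <= B.

Lemma bmf_cst a : bmf (fun=> a).
Proof. by split; [exact: measurable_cst|exists `|a|]. Qed.

Lemma bmfD h g : bmf h -> bmf g -> bmf (fun x => h x + g x).
Proof.
move=> [mh [B hB]] [mg [C gC]]; split; first exact: measurable_funD.
exists (B + C) => x Ox; rewrite (le_trans (ler_normD _ _))// lerD ?hB ?gC//.
Qed.

Lemma bmfM h g : bmf h -> bmf g -> bmf (fun x => h x * g x).
Proof.
move=> [mh [B hB]] [mg [C gC]]; split; first exact: measurable_funM.
by exists (B * C) => x Ox; rewrite normrM ler_pM ?hB ?gC.
Qed.

Lemma bmfZ a h : bmf h -> bmf (fun x => a * h x).
Proof. by move=> bh; apply: bmfM => //; exact: bmf_cst. Qed.

Lemma bmfN h : bmf h -> bmf (fun x => - h x).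
Proof.
by move=> bh; under eq_fun do rewrite -mulN1r; exact: bmfZ.
Qed.

Lemma bmfB h g : bmf h -> bmf g -> bmf (fun x => h x - g x).
Proof. by move=> bh bg; apply: bmfD => //; exact: bmfN. Qed.

Lemma bmf_comp (G : R -> R) h : continuous G -> bmf h -> bmf (fun x => G (h x)).
Proof.
move=> cG [mh [B hB]]; split.
  by apply: measurableT_comp => //; exact: continuous_measurable_fun.
have cK : compact (G @` `[- B, B]).
  apply: continuous_compact; last exact: segment_compact.
  by apply: continuous_subspaceT.
have [C [_ CP]] := compact_bounded cK.
exists (C + 1) => x Ox; apply: (CP (C + 1)); first by rewrite ltrDl.
by exists (h x) => //=; rewrite in_itv/= -ler_norml hB.
Qed.

Variable mu : {measure set T -> \bar R}.
Hypothesis muOm : (mu Om < +oo)%E.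

Lemma bmf_integrable h : bmf h -> mu.-integrable Om (EFin \o h).
Proof.
move=> [mh [B hB]]; apply: measurable_bounded_integrable => //.
by exists B; split; [exact: num_real|move=> x Bx y Oy; apply: ltW;
  apply: le_lt_trans (hB _ Oy) Bx].
Qed.

Lemma bintD h g : bmf h -> bmf g -> \int[mu]_(x in Om) (h x + g x) =
  \int[mu]_(x in Om) h x + \int[mu]_(x in Om) g x.
Proof. by move=> bh bg; rewrite RintegralD//; exact: bmf_integrable. Qed.

Lemma bintB h g : bmf h -> bmf g -> \int[mu]_(x in Om) (h x - g x) =
  \int[mu]_(x in Om) h x - \int[mu]_(x in Om) g x.
Proof. by move=> bh bg; rewrite RintegralB//; exact: bmf_integrable. Qed.

Lemma bintZ a h : bmf h -> \int[mu]_(x in Om) (a * h x) =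
  a * \int[mu]_(x in Om) h x.
Proof. by move=> bh; rewrite RintegralZl//; exact: bmf_integrable. Qed.

Lemma bint_cst a : \int[mu]_(x in Om) (fun=> a) x = a * fine (mu Om).
Proof. by rewrite Rintegral_cst. Qed.

Lemma bint_le h g : bmf h -> bmf g -> (forall x, Om x -> h x <= g x) ->
  \int[mu]_(x in Om) h x <= \int[mu]_(x in Om) g x.
Proof. by move=> bh bg hg; apply: le_Rintegral => //; exact: bmf_integrable. Qed.

Lemma EFin_bint h : bmf h ->
  (\int[mu]_(x in Om) h x)%:E = (\int[mu]_(x in Om) (h x)%:E)%E.
Proof.
by move=> bh; rewrite /Rintegral fineK//; apply: integrable_fin_num => //;
  exact: bmf_integrable.
Qed.

End bounded_measurable.

(** * Functions with the modulus of the cost, and their c-transforms *)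

Section ctransform.
Context {d : measure_display} {T : measurableType d} {R : realType}.
Variables (Om : set T) (c : T -> T -> R) (M : R) (x0 : T).
Hypothesis mOm : measurable Om.
Hypothesis Ox0 : Om x0.
Hypothesis c_sym : forall x y, c x y = c y x.
Hypothesis c_ge0 : forall x y, 0 <= c x y.
Hypothesis c_diag : forall x, c x x = 0.
Hypothesis c_le : forall x y, Om x -> Om y -> c x y <= M.
Hypothesis c_part : forall e : R, 0 < e ->
  exists (I : finType) (g : T -> I) (r : I -> T),
  [/\ forall i, measurable (Om `&` g @^-1` [set i]), forall i, Om (r i) &
      forall x y, Om x -> Om y -> `|c x y - c (r (g x)) y| <= e].
Implicit Types chi phi : T -> R.

(* The class of all functions with the modulus of continuity of the cost; it is
   convex, pointwise closed, and contains all c-transforms. *)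
Definition Lip chi := forall x x' e, Om x -> Om x' ->
  (forall y, Om y -> `|c x y - c x' y| <= e) -> `|chi x - chi x'| <= e.

(** Real counterpart of [ctrans]; on the class [Lip] the infimum is finite and the two agree. *)
Definition ct chi (y : T) : R := inf [set c x y - chi x | x in Om].

Lemma Lip_osc chi x x' : Lip chi -> Om x -> Om x' -> `|chi x - chi x'| <= M.
Proof.
move=> lc Ox Ox'; apply: lc => // y Oy.
by rewrite ler_norml; have := c_ge0 x y; have := c_ge0 x' y;
  have := c_le Ox Oy; have := c_le Ox' Oy; lra.
Qed.

(** [I] carries no sigma-algebra: measurability of [g] is expressed by its fibres, and each preimage
    is a finite union of them. *)
Lemma measurable_part (I : finType) (g : T -> I) (h : I -> R) :
  (forall i, measurable (Om `&` g @^-1` [set i])) ->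
  measurable_fun Om (fun x => h (g x)).
Proof.
move=> mg _ B mB.
have -> : Om `&` (fun x => h (g x)) @^-1` B =
    \big[setU/set0]_(i <- enum I | h i \in B) (Om `&` g @^-1` [set i]).
  apply/seteqP; split => [x [Ox Bx]|x].
    rewrite -bigcup_seq_cond; exists (g x) => //=.
    by rewrite mem_enum/=; exact/mem_set.
  by rewrite -bigcup_seq_cond => -[i /= /andP[_ /set_mem Bi] [Ox gi]];
    split => //=; rewrite gi.
by apply: bigsetU_measurable => i _; exact: mg.
Qed.

(** On partitions of precision [1/(n+1)], the step functions [chi (r (g x))] converge uniformly to
    [chi], which gives measurability; the bound comes from the oscillation being at most [M]. *)
Lemma Lip_bmf chi : Lip chi -> bmf Om chi.
Proof.
move=> lc; split; last first.
  exists (`|chi x0| + M) => x Ox; have := Lip_osc lc Ox Ox0.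
  have := ler_normD (chi x - chi x0) (chi x0); rewrite subrK.
  by lra.
have e0 n : 0 < n.+1%:R^-1 :> R by rewrite invr_gt0.
pose h n x : R := let I := projT1 (cid (c_part (e0 n))) in
  let gr := cid (projT2 (cid (c_part (e0 n)))) in
  chi (projT1 (cid (projT2 gr)) (projT1 gr x)).
apply: (@measurable_fun_cvg _ _ _ _ h) => [n|x Ox].
  rewrite /h; case: cid => I /= H; case: cid => g /= {}H;
    case: cid => r [mg _ _] /=.
  exact: (@measurable_part I g (fun i => chi (r i)) mg).
apply/cvgrPdist_le => e ep; near=> n.
apply: (@le_trans _ _ n.+1%:R^-1); last first.
  by apply: ltW; near: n; exact: near_infty_natSinv_lt (PosNum ep).
rewrite /h; case: cid => I /= H; case: cid => g /= {}H;
  case: cid => r [mg Or cr] /=.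
by apply: lc => // y Oy; exact: cr.
Unshelve. all: by end_near. Qed.

Lemma ct_has_inf chi y : Lip chi -> has_inf [set c x y - chi x | x in Om].
Proof.
move=> lc; split; first by exists (c x0 y - chi x0); exists x0.
exists (- chi x0 - M) => _ [x Ox <-].
have := Lip_osc lc Ox Ox0; rewrite ler_norml => /andP[_ h].
by have := c_ge0 x y; lra.
Qed.

Lemma ct_le chi x y : Lip chi -> Om x -> ct chi y <= c x y - chi x.
Proof.
move=> lc Ox; apply: ge_inf; last by exists x.
by have [] := ct_has_inf y lc.
Qed.

Lemma ct_ge chi v y : (forall x, Om x -> v <= c x y - chi x) -> v <= ct chi y.
Proof.
move=> h; apply: lb_le_inf; first by exists (c x0 y - chi x0); exists x0.
by move=> _ [x Ox <-]; exact: h.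
Qed.

Lemma ct_Lip chi : Lip chi -> Lip (ct chi).
Proof.
move=> lc y y' e Oy Oy' H.
have aux z z' : (forall x, Om x -> `|c z x - c z' x| <= e) ->
    ct chi z - e <= ct chi z'.
  move=> h; apply: ct_ge => x Ox.
  have := ct_le z lc Ox; have := h _ Ox.
  by rewrite !(c_sym x) ler_norml => /andP[? ?]; lra.
rewrite ler_norml; have h1 := aux _ _ H.
have h2 : ct chi y' - e <= ct chi y by apply: aux => x Ox; rewrite distrC H.
by apply/andP; split; lra.
Qed.

Lemma Lip_shift chi a : Lip chi -> Lip (fun x => chi x + a).
Proof.
move=> lc x x' e Ox Ox' H; have -> : chi x + a - (chi x' + a) = chi x - chi x'.
  by ring.
exact: lc.
Qed.

Lemma ct_shift chi a y : Lip chi -> ct (fun x => chi x + a) y = ct chi y - a.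
Proof.
move=> lc; apply/eqP; rewrite eq_le; apply/andP; split.
  rewrite lerBrDr; apply: ct_ge => x Ox.
  by have := ct_le y (Lip_shift a lc) Ox; lra.
by apply: ct_ge => x Ox; have := ct_le y lc Ox; lra.
Qed.

Lemma Lip_conv chi phi t : 0 <= t -> t <= 1 -> Lip chi -> Lip phi ->
  Lip (fun x => (1 - t) * chi x + t * phi x).
Proof.
move=> t0 t1 lc lp x x' e Ox Ox' H.
have -> : (1 - t) * chi x + t * phi x - ((1 - t) * chi x' + t * phi x') =
  (1 - t) * (chi x - chi x') + t * (phi x - phi x') by ring.
rewrite (le_trans (ler_normD _ _))// !normrM (ger0_norm t0) ger0_norm ?subr_ge0//.
have -> : e = (1 - t) * e + t * e by ring.
by rewrite lerD// ler_wpM2l ?subr_ge0// ?lc ?lp.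
Qed.

Lemma ct_conv chi phi t y : 0 <= t -> t <= 1 -> Lip chi -> Lip phi ->
  (1 - t) * ct chi y + t * ct phi y <=
  ct (fun x => (1 - t) * chi x + t * phi x) y.
Proof.
move=> t0 t1 lc lp; apply: ct_ge => x Ox.
have -> : c x y - ((1 - t) * chi x + t * phi x) =
  (1 - t) * (c x y - chi x) + t * (c x y - phi x) by ring.
by rewrite lerD// ler_wpM2l ?subr_ge0// ct_le.
Qed.

Lemma Lip_min chi a : Lip chi -> Lip (fun x => Num.min (chi x) a).
Proof.
move=> lc x x' e Ox Ox' H; have := lc x x' e Ox Ox' H.
have e0 : 0 <= e by rewrite (le_trans _ (H _ Ox0)).
rewrite !ler_norml; case: (leP (chi x) a); case: (leP (chi x') a); lra.
Qed.

Lemma ct_mono chi phi y : Lip chi -> Lip phi ->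
  (forall x, Om x -> chi x <= phi x) -> ct phi y <= ct chi y.
Proof.
move=> lc lp cp; apply: ct_ge => x Ox.
by have := ct_le y lp Ox; have := cp _ Ox; lra.
Qed.

Lemma ctct_ge chi x : Lip chi -> Om x -> chi x <= ct (ct chi) x.
Proof.
move=> lc Ox; apply: ct_ge => y Oy.
by have := ct_le y lc Ox; rewrite (c_sym y); lra.
Qed.

Lemma ctctct_ge chi y : Lip chi -> Om y -> ct chi y <= ct (ct (ct chi)) y.
Proof. by move=> lc Oy; apply: ctct_ge => //; exact: ct_Lip. Qed.

(** From [chi <= 0 <= c] the transform [ct chi] is nonnegative; in the second infimum the point [x]
    itself, at zero cost, then gives a nonpositive value. *)
Lemma ctct_le0 chi x : Lip chi -> (forall x, Om x -> chi x <= 0) ->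
  Om x -> ct (ct chi) x <= 0.
Proof.
move=> lc c0 Ox; have := ct_le x (ct_Lip lc) Ox; rewrite c_diag sub0r.
have : 0 <= ct chi x.
  by apply: ct_ge => y Oy; have := c_ge0 y x; have := c0 _ Oy; lra.
by lra.
Qed.

Lemma ct_dist chi phi e y : Lip chi -> Lip phi ->
  (forall x, Om x -> `|chi x - phi x| <= e) -> `|ct chi y - ct phi y| <= e.
Proof.
move=> lc lp H; rewrite ler_norml; apply/andP; split.
  rewrite lerBrDr; apply: ct_ge => x Ox; have := ct_le y lp Ox.
  by have := H _ Ox; rewrite ler_norml => /andP[]; lra.
rewrite lerBlDr -lerBlDl; apply: ct_ge => x Ox; have := ct_le y lc Ox.
by have := H _ Ox; rewrite ler_norml => /andP[]; lra.
Qed.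

End ctransform.

(** * The dual problem *)

Section cluster.
Import ArrowAsProduct.

(** [T] may be uncountable, so Tychonoff's theorem gives a cluster point rather than a convergent
    subsequence: arbitrarily late terms approximate [phi], at finitely many points at a time. *)
Lemma pointwise_cluster (R : realType) (T : eqType) (h : nat -> T -> R) (B : R) :
  (forall n x, `|h n x| <= B) ->
  exists phi : T -> R, forall (I : finType) (r : I -> T) (e : R) (N : nat),
    0 < e -> exists2 n, (N <= n)%N & forall i, `|phi (r i) - h n (r i)| < e.
Proof.
move=> hB.
have := @tychonoff T (fun=> R) (fun=> `[- B, B]%classic)
  (fun=> @segment_compact _ _ _).
have hF : nbhs (h @ \oo) [set g : T -> R | forall i, `[- B, B]%classic (g i)].
  by exists 0%N => // n _ x /=; rewrite in_itv/= -ler_norml; exact: hB.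
move=> /(_ (h @ \oo) (fmap_proper_filter h _) hF) [].
move=> phi [_ clphi]; exists phi => I r e N e0.
have [] := clphi [set g | exists2 n, (N <= n)%N & g = h n]
  [set g | forall i, `|phi (r i) - g (r i)| < e].
- by exists N => // n /= Nn; exists n.
- pose U := prod_topology (fun _ : T => R).
  apply: (@filter_forall U _ (fun i (g : U) => `|phi (r i) - g (r i)| < e) _
    (nbhs_filter (phi : U))) => i.
  have := @proj_continuous T (fun=> R) (r i) phi.
  by move=> /cvgrPdist_lt/(_ _ e0).
by move=> g [[n Nn ->] H]; exists n.
Qed.

End cluster.

Section dual.
Context {d : measure_display} {T : measurableType d} {R : realType}.
Variables (Om : set T) (c : T -> T -> R) (M : R) (x0 : T).
Hypothesis mOm : measurable Om.
Hypothesis Ox0 : Om x0.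
Hypothesis c_sym : forall x y, c x y = c y x.
Hypothesis c_ge0 : forall x y, 0 <= c x y.
Hypothesis c_diag : forall x, c x x = 0.
Hypothesis c_le : forall x y, Om x -> Om y -> c x y <= M.
Hypothesis c_part : forall e : R, 0 < e ->
  exists (I : finType) (g : T -> I) (r : I -> T),
  [/\ forall i, measurable (Om `&` g @^-1` [set i]), forall i, Om (r i) &
      forall x y, Om x -> Om y -> `|c x y - c (r (g x)) y| <= e].
Variables lam nu : {measure set T -> \bar R}.
Hypothesis lam_gt0 : (0 < lam Om)%E.
Hypothesis lam_fin : (lam Om < +oo)%E.
Hypothesis nu1 : nu Om = 1%E.
Variables H kp : R -> R.
Hypothesis H_sub : forall s s', H s' - H s <= kp s' * (s' - s).
Hypothesis H_ge0 : forall s, 0 <= H s.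
Hypothesis H_le0 : forall s, s <= 0 -> H s = 0.
Hypothesis H_coercive : forall t, 0 <= t -> exists C, forall s, s * t - C <= H s.
Hypothesis H_continuous : continuous H.
Hypothesis H_homo : {homo H : s s' / s <= s'}.
Hypothesis kp_ge0 : forall s, 0 <= kp s.
Hypothesis kp_homo : {homo kp : s s' / s <= s'}.
Hypothesis kp_continuous : continuous kp.
Implicit Types chi phi : T -> R.

Let LipT := Lip Om c.
Let ctT := ct Om c.
Let L := fine (lam Om).

Let L_gt0 : 0 < L.
Proof. by rewrite fine_gt0// lam_gt0. Qed.

Let nu_fin : (nu Om < +oo)%E. Proof. by rewrite nu1 ltry. Qed.

Let lip_bmf chi : LipT chi -> bmf Om chi.
Proof. exact: Lip_bmf Ox0 c_ge0 c_le c_part _. Qed.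

Let lip_osc chi x x' : LipT chi -> Om x -> Om x' -> `|chi x - chi x'| <= M.
Proof. exact: Lip_osc. Qed.

Let ct_lip chi : LipT chi -> LipT (ctT chi).
Proof. exact: (ct_Lip Ox0 c_sym c_ge0 c_le). Qed.

Let ct_bmf chi : LipT chi -> bmf Om (ctT chi).
Proof. by move=> lc; exact/lip_bmf/ct_lip. Qed.

Let H_bmf chi : LipT chi -> bmf Om (fun x => H (- chi x)).
Proof. by move=> lc; apply: bmf_comp => //; exact/bmfN/lip_bmf. Qed.

Definition dual chi : R :=
  \int[nu]_(y in Om) ctT chi y - \int[lam]_(x in Om) H (- chi x).

Lemma bint_nu_cst a : \int[nu]_(y in Om) (fun=> a) y = a.
Proof. by rewrite bint_cst// nu1 mulr1. Qed.

Lemma dual_coercive : exists K, forall chi, LipT chi ->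
  dual chi <= K - `|chi x0|.
Proof.
(* When [chi x0] tends to minus infinity the [nu] term grows at most like [- chi x0]. With slope
   [2 / L], the penalty integrated over [Om] grows twice as fast. *)
pose t := 2 / L; have t0 : 0 <= t by rewrite divr_ge0 ?ltW.
have tL : t * L = 2 by rewrite mulfVK ?gt_eqF.
have [C HC] := H_coercive t0.
exists (Num.max M (3 * M + C * L)) => chi lc; rewrite /dual.
have h1 : \int[nu]_(y in Om) ctT chi y <= M - chi x0.
  rewrite -[leRHS]bint_nu_cst; apply: bint_le => //;
    [exact: ct_bmf|exact: bmf_cst|].
  move=> y Oy; rewrite (le_trans (ct_le Ox0 c_ge0 c_le _ lc Ox0))//.
  by rewrite lerB// c_le.
have h2 : 0 <= \int[lam]_(x in Om) H (- chi x) by apply: Rintegral_ge0.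
have h3 : ((- chi x0 - M) * t - C) * L <= \int[lam]_(x in Om) H (- chi x).
  rewrite -(bint_cst mOm lam); apply: bint_le => //;
    [exact: bmf_cst|exact: H_bmf|].
  move=> x Ox; rewrite (le_trans _ (HC _))// lerB// ler_wpM2r//.
  by have := lip_osc lc Ox Ox0; rewrite ler_norml => /andP[]; lra.
have {}h3 : 2 * (- chi x0 - M) - C * L <= \int[lam]_(x in Om) H (- chi x).
  by rewrite -tL; move: h3; lra.
rewrite lerBrDr; have [x00|x00] := leP 0 (chi x0).
  by rewrite ger0_norm// le_max; apply/orP; left; lra.
by rewrite ltr0_norm// le_max; apply/orP; right; lra.
Qed.

(** Continuity of the functional for uniform distance: the c-transform is nonexpansive, and [kp B]
    bounds the subgradients of [H] at the points [- phi x]. *)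
Lemma dual_dist chi phi B e : LipT chi -> LipT phi ->
  (forall x, Om x -> `|chi x| <= B) -> (forall x, Om x -> `|phi x| <= B) ->
  (forall x, Om x -> `|chi x - phi x| <= e) ->
  dual chi <= dual phi + e * (1 + kp B * L).
Proof.
move=> lc lp cB pB cp; rewrite /dual.
have h1 : \int[nu]_(y in Om) ctT chi y <= \int[nu]_(y in Om) ctT phi y + e.
  rewrite -[X in _ + X]bint_nu_cst -(bintD mOm nu_fin) //;
    [|exact: ct_bmf|exact: bmf_cst].
  apply: bint_le => //; [exact: ct_bmf|apply: bmfD => //;
    [exact: ct_bmf|exact: bmf_cst]|].
  move=> y Oy; have := ct_dist Ox0 c_ge0 c_le y lc lp cp.
  by rewrite ler_norml => /andP[]; rewrite -/ctT; lra.
have h2 : \int[lam]_(x in Om) H (- phi x) <=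
    \int[lam]_(x in Om) H (- chi x) + e * kp B * L.
  rewrite -(bint_cst mOm lam) -(bintD mOm lam_fin) //;
    [|exact: H_bmf|exact: bmf_cst].
  apply: bint_le => //; [exact: H_bmf|apply: bmfD => //;
    [exact: H_bmf|exact: bmf_cst]|].
  move=> x Ox; rewrite -lerBlDl (le_trans (H_sub _ _))//.
  rewrite opprK addrC (mulrC e).
  rewrite (@le_trans _ _ (kp (- phi x) * e))//.
    by rewrite ler_wpM2l//; have := cp _ Ox; rewrite ler_norml => /andP[]; lra.
  rewrite ler_wpM2r//; first by rewrite (le_trans _ (cp _ Ox)).
  by apply: kp_homo; have := pB _ Ox; rewrite ler_norml => /andP[]; lra.
by move: h1 h2; lra.
Qed.

Lemma dual_eq chi phi : (forall x, Om x -> chi x = phi x) -> dual chi = dual phi.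
Proof.
move=> cp; rewrite /dual; congr (_ - _); apply: eq_Rintegral => x;
  rewrite inE => Ox.
  rewrite /ctT /ct; congr inf; apply: eq_imagel => y Oy; rewrite cp//.
by rewrite cp.
Qed.

Lemma dual_has_max : exists2 phi, LipT phi &
  forall chi, LipT chi -> dual chi <= dual phi.
Proof.
have [K DK] := dual_coercive.
have L0 : LipT (fun=> 0).
  move=> x x' e Ox Ox' h; rewrite subrr normr0.
  by rewrite (le_trans _ (h _ Ox0)).
have D0 : 0 <= dual (fun=> 0).
  rewrite /dual subr_ge0; apply: (@le_trans _ _ 0).
    under eq_Rintegral do rewrite oppr0 (H_le0 (lexx 0)).
    by rewrite (bint_cst mOm lam) mul0r.
  apply: Rintegral_ge0 => y Oy; apply: (ct_ge Ox0) => x Ox.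
  by rewrite subr0.
pose E := [set dual chi | chi in LipT].
have hE : has_sup E.
  split; first by exists (dual (fun=> 0)), (fun=> 0).
  exists K => _ [chi lc <-]; rewrite (le_trans (DK _ lc))//.
  by rewrite gerBl.
have ex n : exists chi, [/\ LipT chi, sup E - n.+1%:R^-1 < dual chi &
    forall x, `|chi x| <= K + 1 + M].
  have n0 : 0 < n.+1%:R^-1 :> R by rewrite invr_gt0.
  have [_ [chi lc <-] hn] := sup_adherent n0 hE.
  (* The value 0 off [Om] makes the bound hold on all of [T], as [pointwise_cluster] requires;
     [dual] only sees [Om]. *)
  pose chi' x := if x \in Om then chi x else 0.
  have cc x : Om x -> chi' x = chi x by move=> Ox; rewrite /chi' mem_set.
  (* [sup E] is at least [dual] of the zero function, hence nonnegative; so [dual chi > -1], and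
     coercivity applies. *)
  have b0 : `|chi x0| <= K + 1.
    have := DK _ lc.
    have : dual (fun=> 0) <= sup E by apply: sup_upper_bound => //;
      exists (fun=> 0).
    have : n.+1%:R^-1 <= 1 :> R by rewrite invf_le1 ?ler1n.
    by move: hn D0; move: (n.+1%:R^-1) (dual (fun=> 0)) => q D; lra.
  exists chi'; split.
  - by move=> x x' e Ox Ox' h; rewrite !cc//; exact: lc.
  - by rewrite (dual_eq cc).
  - move=> x; rewrite /chi'; case: ifPn => [/set_mem Ox|_].
      have := lip_osc lc Ox Ox0; have := ler_normD (chi x - chi x0) (chi x0).
      by rewrite subrK; lra.
    rewrite normr0; have := normr_ge0 (chi x0).
    by have := lip_osc lc Ox0 Ox0; rewrite subrr normr0; lra.
have [h hP] := choice ex.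
have hB n x : `|h n x| <= K + 1 + M by have [_ _] := hP n.
have [phi phiP] := pointwise_cluster hB.
have lphi : LipT phi.
  move=> x x' e Ox Ox' He; apply/ler_addgt0Pr => z z0.
  have z2 : 0 < z / 2 by rewrite divr_gt0.
  have [n _ hn] := phiP _ (fun b : bool => if b then x else x') _ 0%N z2.
  have := hn true; have := hn false => /=.
  have [ln _ _] := hP n; have := ln _ _ _ Ox Ox' He.
  by rewrite !ler_norml !ltr_norml => /andP[? ?] /andP[? ?] /andP[? ?]; lra.
have phiB x : `|phi x| <= K + 1 + M.
  apply/ler_addgt0Pr => z z0.
  have [n _ /(_ tt)/= hn] := phiP _ (fun b : unit => x) _ 0%N z0.
  have := hB n x; have := ler_normD (phi x - h n x) (h n x).
  by rewrite subrK; lra.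
exists phi => // chi lc.
have : dual chi <= sup E by apply: sup_upper_bound => //; exists chi.
move=> /le_trans; apply; apply/ler_addgt0Pr => z z0.
(* Two errors must fit into [z]: [1/(n+1) < e] for the maximizing sequence, and the bound of
   [dual_dist] at distance [3 * e]. *)
pose G := 4 * (1 + kp (K + 1 + M) * L) + 1.
have G0 : 0 < G by rewrite ltr_wpDl// mulr_ge0// addr_ge0// mulr_ge0// ltW.
pose e := z / G; have e0 : 0 < e by rewrite divr_gt0.
have [N _ HN] := near_infty_natSinv_lt (PosNum e0).
have [I [g [r [_ Or cr]]]] := c_part e0.
have [n Nn hn] := phiP I r e N e0.
have [ln Dn _] := hP n.
(* Closeness at the finitely many representatives spreads to [Om], because [h n] and [phi] each vary
   by at most [e] between a point and its representative. *)
have close x : Om x -> `|h n x - phi x| <= 3 * e.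
  move=> Ox; have a1 := hn (g x).
  have a2 : `|h n x - h n (r (g x))| <= e by apply: ln => // y Oy; exact: cr.
  have a3 : `|phi x - phi (r (g x))| <= e by apply: lphi => // y Oy; exact: cr.
  by move: a1 a2 a3; rewrite !ler_norml !ltr_norml => /andP[? ?] /andP[? ?]
    /andP[? ?]; lra.
have := dual_dist ln lphi (fun x _ => hB n x) (fun x _ => phiB x) close.
have := HN n Nn; rewrite /= => hN.
have eG : e * G = z by rewrite /e mulfVK// gt_eqF.
have : e * G = 4 * (e * (1 + kp (K + 1 + M) * L)) + e by rewrite /G; ring.
have : 0 <= e * (1 + kp (K + 1 + M) * L).
  apply: mulr_ge0; first exact: ltW.
  by rewrite addr_ge0// mulr_ge0// ltW.
rewrite eG -(mulrA 3); move: hN Dn; move: (n.+1%:R^-1) => q.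
by lra.
Qed.

(** Lowering [chi] raises its c-transform, and the penalty does not change because [H] vanishes on
    nonpositive numbers. *)
Lemma dual_min chi : LipT chi -> dual chi <= dual (fun x => Num.min (chi x) 0).
Proof.
move=> lc; rewrite /dual; have lm := Lip_min Ox0 0 lc.
apply: lerB.
  apply: bint_le => //; [exact: ct_bmf|exact: ct_bmf|] => y Oy.
  by apply: (ct_mono Ox0 c_ge0 c_le y lm lc) => x Ox; rewrite ge_min lexx.
rewrite le_eqVlt; apply/orP; left; apply/eqP; apply: eq_Rintegral => x _.
by case: leP => // h; rewrite !H_le0// ?oppr0// oppr_le0 ltW.
Qed.

(** The double transform lies above [chi], which lowers the penalty since [H] is monotone; the same
    inequality for [ct chi] shows that the [nu] term does not decrease. *)
Lemma dual_ctct chi : LipT chi -> dual chi <= dual (ctT (ctT chi)).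
Proof.
move=> lc; rewrite /dual; apply: lerB.
  apply: bint_le => //; [exact: ct_bmf|exact/ct_bmf/ct_lip/ct_lip|] => y Oy.
  exact: (ctctct_ge Ox0 c_sym c_ge0 c_le).
apply: bint_le => //; [exact/H_bmf/ct_lip/ct_lip|exact: H_bmf|] => x Ox.
by apply: H_homo; rewrite lerN2; exact: (ctct_ge Ox0 c_sym c_ge0 c_le).
Qed.

Lemma dual_cconcave_max : exists psi, [/\ LipT psi,
  exists2 phi, LipT phi & psi = ctT phi, (forall x, Om x -> psi x <= 0) &
  forall chi, LipT chi -> dual chi <= dual psi].
Proof.
have [phi lp phiM] := dual_has_max.
pose phi0 x := Num.min (phi x) 0.
have lp0 : LipT phi0 by exact: (Lip_min Ox0 0 lp).
exists (ctT (ctT phi0)); split.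
- exact/ct_lip/ct_lip.
- by exists (ctT phi0) => //; exact: ct_lip.
- move=> x Ox; apply: (ctct_le0 Ox0 c_sym c_ge0 c_diag c_le) => // y Oy.
  by rewrite /phi0 ge_min lexx orbT.
- move=> chi lc; rewrite (le_trans (phiM _ lc))// (le_trans (dual_min lp))//.
  exact: dual_ctct.
Qed.

Section variation.
Variable psi : T -> R.
Hypothesis lpsi : LipT psi.
Hypothesis psi_max : forall chi, LipT chi -> dual chi <= dual psi.
Variable chi : T -> R.
Hypothesis lchi : LipT chi.

Let chit (t : R) x := (1 - t) * psi x + t * chi x.

Let chit_bmf t : 0 <= t -> t <= 1 ->
  bmf Om (fun x => kp (- chit t x) * (psi x - chi x)).
Proof.
move=> t0 t1; apply: bmfM => //.
  by apply: bmf_comp => //; apply: bmfN => //; apply: lip_bmf; exact: Lip_conv.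
by apply: bmfB => //; exact: lip_bmf.
Qed.

(** Concavity of the c-transform bounds the [nu] term from below. The subgradient of [H], taken at
    the perturbed function [chit t], bounds the change of penalty from above; both are proportional
    to [t]. *)
Lemma dual_variation_step t : 0 < t -> t <= 1 ->
  \int[nu]_(y in Om) ctT chi y - \int[nu]_(y in Om) ctT psi y <=
  \int[lam]_(x in Om) (kp (- chit t x) * (psi x - chi x)).
Proof.
move=> t0 t1; have lt : LipT (chit t) by apply: Lip_conv => //; exact: ltW.
have := psi_max lt; rewrite /dual => hD.
have h1 : (1 - t) * \int[nu]_(y in Om) ctT psi y + t * \int[nu]_(y in Om) ctT
  chi y
    <= \int[nu]_(y in Om) ctT (chit t) y.
  rewrite -!(bintZ mOm nu_fin) -?(bintD mOm nu_fin);
    try by [exact: ct_bmf|exact/bmfZ/ct_bmf].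
  apply: bint_le => //; [|exact: ct_bmf|].
    by apply: bmfD => //; apply: bmfZ => //; exact: ct_bmf.
  by move=> y Oy; apply: (ct_conv Ox0 c_ge0 c_le) => //; exact: ltW.
have h2 : \int[lam]_(x in Om) H (- chit t x) - \int[lam]_(x in Om) H (- psi x) <=
    t * \int[lam]_(x in Om) (kp (- chit t x) * (psi x - chi x)).
  have bt := chit_bmf (ltW t0) t1.
  rewrite -(bintZ mOm lam_fin)// -(bintB mOm lam_fin);
    try exact: H_bmf.
  apply: bint_le => //; [by apply: bmfB => //; exact: H_bmf|exact: bmfZ|].
  move=> x Ox; rewrite (le_trans (H_sub _ _))// mulrCA ler_wpM2l//.
  by rewrite /chit; lra.
by rewrite -(ler_pM2l t0); move: hD h1 h2; lra.
Qed.

Lemma dual_variation :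
  \int[nu]_(y in Om) ctT chi y + \int[lam]_(x in Om) (kp (- psi x) * chi x) <=
  \int[nu]_(y in Om) ctT psi y + \int[lam]_(x in Om) (kp (- psi x) * psi x).
Proof.
have bk : bmf Om (fun x => kp (- psi x)).
  by apply: bmf_comp => //; apply: bmfN => //; exact: lip_bmf.
have bpc : bmf Om (fun x => psi x - chi x) by apply: bmfB => //; exact: lip_bmf.
suff : \int[nu]_(y in Om) ctT chi y - \int[nu]_(y in Om) ctT psi y <=
    \int[lam]_(x in Om) (kp (- psi x) * (psi x - chi x)).
  have -> : \int[lam]_(x in Om) (kp (- psi x) * (psi x - chi x)) =
    \int[lam]_(x in Om) (kp (- psi x) * psi x) -
    \int[lam]_(x in Om) (kp (- psi x) * chi x).
    rewrite -(bintB mOm lam_fin);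
      try by apply: bmfM => //; exact: lip_bmf.
    by apply: eq_Rintegral => x _; rewrite mulrBr.
  by lra.
pose t n : R := n.+1%:R^-1.
have t0 n : 0 < t n by rewrite invr_gt0.
have t1 n : t n <= 1 by rewrite invf_le1 ?ler1n.
pose F n x := (kp (- chit (t n) x) * (psi x - chi x))%:E.
have [_ [Bp psiB]] := lip_bmf lpsi.
have [_ [Bc chiB]] := lip_bmf lchi.
have [_ [Bd dB]] := bpc.
rewrite -lee_fin (EFin_bint mOm lam_fin); last exact: bmfM.
(* As [t] tends to 0 the subgradients converge by continuity of [kp]. The dominating constant uses
   that [kp] is monotone and that [chit] is bounded by [Bp + Bc]. *)
have [|||||_ _ lim] := @dominated_convergence _ _ _ lam Om mOm F
    (fun x => (kp (- psi x) * (psi x - chi x))%:E)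
    (EFin \o (fun=> kp (Bp + Bc) * Bd)).
- move=> n; apply/measurable_EFinP.
  by have [] := chit_bmf (ltW (t0 n)) (t1 n).
- by apply/measurable_EFinP; have [] := bmfM bk bpc.
- apply: aeW => x Ox.
  have ct0 : - chit (t n) x @[n --> \oo] --> - psi x.
    apply: cvgN.
    have -> : (fun n => chit (t n) x) = (fun n => psi x + t n * (chi x - psi x)).
      by apply: funext => n; rewrite /chit; ring.
    rewrite -[X in _ --> X]addr0 -(mul0r (chi x - psi x)).
    apply: cvgD; first exact: cvg_cst.
    by apply: cvgM; [exact: cvg_harmonic|exact: cvg_cst].
  have lim0 : kp (- chit (t n) x) * (psi x - chi x) @[n --> \oo] -->
      kp (- psi x) * (psi x - chi x).
    apply: cvgM; last exact: cvg_cst.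
    exact: (cvg_comp _ _ ct0 (@kp_continuous _)).
  by apply: cvg_EFin; [exact: nearW|exact: lim0].
- exact/bmf_integrable/bmf_cst.
- apply: aeW => x n Ox; rewrite /F/= lee_fin normrM ler_pM//; last exact: dB.
  rewrite ger0_norm//; apply: kp_homo.
  rewrite (le_trans (ler_norm _))// normrN /chit (le_trans (ler_normD _ _))//.
  rewrite !normrM lerD//.
    rewrite -[leRHS]mul1r ler_pM ?psiB// ger0_norm ?subr_ge0//.
    by rewrite gerBl ltW.
  by rewrite -[leRHS]mul1r ler_pM ?chiB// ger0_norm// ltW.
rewrite -(cvg_lim _ lim)//; apply: lime_ge.
  by apply/cvg_ex; eexists; exact: lim.
apply: nearW => n.
apply: (@le_trans _ _ (\int[lam]_(x in Om) (kp (- chit (t n) x) * (psi x - chi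
  x)))%:E).
  by rewrite lee_fin; exact: dual_variation_step.
by rewrite (EFin_bint mOm lam_fin (chit_bmf (ltW (t0 n)) (t1 n))).
Qed.

End variation.

End dual.

(** * Densities and marginals *)

Section density_probability.
Context {d : measure_display} {T : measurableType d} {R : realType}.
Variables (lam : {measure set T -> \bar R}) (u : T -> R).
Hypothesis mu_ : measurable_fun setT u.
Hypothesis u_ge0 : forall x, 0 <= u x.
Hypothesis u1 : (\int[lam]_x (u x)%:E = 1)%E.

Definition density_measure (A : set T) : \bar R := (\int[lam]_(x in A) (u
  x)%:E)%E.

Let density0 : density_measure set0 = 0%E.
Proof. by rewrite /density_measure integral_set0. Qed.

Let density_ge0 A : (0 <= density_measure A)%E.
Proof. by apply: integral_ge0 => x _; rewrite lee_fin. Qed.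

Let density_sigma_additive : semi_sigma_additive density_measure.
Proof.
move=> /= A mA tA mUA; rewrite /density_measure ge0_integral_bigcup//=.
- apply: is_cvg_ereal_nneg_natsum_cond => n _ _.
  by apply: integral_ge0 => x _; rewrite lee_fin.
- by apply/measurable_EFinP; exact: measurable_funTS.
- by move=> x _; rewrite lee_fin.
Qed.

HB.instance Definition _ := isMeasure.Build _ _ _ density_measure
  density0 density_ge0 density_sigma_additive.

HB.instance Definition _ := Measure_isProbability.Build _ _ _ density_measure u1.

Lemma density_probability : exists mu : probability T R,
  forall A, mu A = (\int[lam]_(x in A) (u x)%:E)%E.
Proof. by exists density_measure. Qed.

End density_probability.

Section integral_part.
Context {d : measure_display} {S : measurableType d} {R : realType}.
Variables (m : {measure set S -> \bar R}) (D : set S) (u : S -> R).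
Variables (I : finType) (g : S -> I).
Hypothesis mD : measurable D.
Hypothesis mg : forall i, measurable (D `&` g @^-1` [set i]).
Hypothesis iu : m.-integrable D (EFin \o u).

Lemma integrable_bmfM h : bmf D h -> m.-integrable D (EFin \o (fun s => h s * u
  s)).
Proof.
move=> [mh [B hB]].
have -> : EFin \o (fun s => h s * u s) = ((EFin \o h) \* (EFin \o u))%E.
  by apply: funext => s /=; rewrite EFinM.
apply: integrableMr => //; exists B; split; first exact: num_real.
by move=> x Bx s Ds; apply: le_trans (hB _ Ds) (ltW Bx).
Qed.

Lemma bmf_part (h : I -> R) : bmf D (fun s => h (g s)).
Proof.
split; first exact: measurable_part.
exists (\sum_i `|h i|) => s _; rewrite (bigD1 (g s))//= lerDl.
exact: sumr_ge0.
Qed.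

(** The weight [u] is merely integrable: this covers the constant weight 1 as well as possibly
    unbounded densities. *)
Lemma Rintegral_part (h : I -> R) :
  \int[m]_(s in D) (h (g s) * u s) =
  \sum_i h i * \int[m]_(s in D `&` g @^-1` [set i]) u s.
Proof.
pose t i s := h i * (u \_ (g @^-1` [set i])) s.
have tE s : h (g s) * u s = \sum_i t i s.
  rewrite (bigD1 (g s))//= big1 ?addr0.
    by rewrite /t patchE mem_set.
  by move=> i ig; rewrite /t patchE memNset ?mulr0//= => /esym/eqP; exact/negP.
have it0 i : m.-integrable D (EFin \o (u \_ (g @^-1` [set i]))).
  have := integrable_bmfM (bmf_part (fun j => (j == i)%:R)).
  apply: eq_integrable => // s _ /=; rewrite patchE; congr EFin.
  case: ifPn => [/set_mem/= ->|/negP h0]; first by rewrite eqxx mul1r.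
  by case: eqP => [e|_]; [exfalso; apply: h0; exact: mem_set|rewrite mul0r].
have it i : m.-integrable D (EFin \o t i).
  have -> : EFin \o t i = (fun s => (h i)%:E * (EFin \o (u \_ (g @^-1` [set
    i]))) s)%E.
    by apply: funext => s /=; rewrite EFinM.
  exact: integrableZl.
under eq_Rintegral do rewrite tE.
have -> : \int[m]_(s in D) (\sum_i t i s) = \sum_i \int[m]_(s in D) t i s.
  elim: (index_enum I) => [|i r IH].
    under eq_Rintegral do rewrite big_nil.
    by rewrite big_nil Rintegral_cst// mul0r.
  under eq_Rintegral do rewrite big_cons.
  rewrite RintegralD//; first by rewrite IH big_cons.
  have -> : EFin \o (fun s => \sum_(j <- r) t j s) =
      (fun s => \sum_(j <- r) (EFin \o t j) s)%E.
    by apply: funext => s /=; rewrite sumEFin.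
  exact: integrable_sum.
apply: eq_bigr => i _; rewrite RintegralZl//; congr (_ * _).
by rewrite Rintegral_mkcondr.
Qed.

End integral_part.

(** * Change of variables for functions of class [Lip] *)

Section transfer.
Context {d d' : measure_display} {T : measurableType d} {S : measurableType d'}
  {R : realType}.
Variables (Om : set T) (c : T -> T -> R) (M : R) (x0 : T).
Hypothesis mOm : measurable Om.
Hypothesis Ox0 : Om x0.
Hypothesis c_ge0 : forall x y, 0 <= c x y.
Hypothesis c_le : forall x y, Om x -> Om y -> c x y <= M.
Hypothesis c_part : forall e : R, 0 < e ->
  exists (I : finType) (g : T -> I) (r : I -> T),
  [/\ forall i, measurable (Om `&` g @^-1` [set i]), forall i, Om (r i) &
      forall x y, Om x -> Om y -> `|c x y - c (r (g x)) y| <= e].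
Variables (mu : {measure set T -> \bar R}) (m : {measure set S -> \bar R}).
Hypothesis mu_fin : (mu Om < +oo)%E.
Variables (D : set S) (pr : S -> T) (u : S -> R).
Hypothesis mD : measurable D.
Hypothesis prD : forall s, D s -> Om (pr s).
Hypothesis mpr : measurable_fun D pr.
Hypothesis u_ge0 : forall s, D s -> 0 <= u s.
Hypothesis iu : m.-integrable D (EFin \o u).
Hypothesis mu_pr : forall A, measurable A -> A `<=` Om ->
  (\int[m]_(s in D `&` pr @^-1` A) (u s)%:E = mu A)%E.

(* Both integrals are within [e * mu Om] of the same finite sum. *)
Lemma Lip_transfer chi : Lip Om c chi ->
  \int[m]_(s in D) (chi (pr s) * u s) = \int[mu]_(x in Om) chi x.
Proof.
move=> lc; apply/eqP; rewrite -subr_eq0 -normr_le0; apply/ler_addgt0Pr => e e0.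
rewrite add0r.
have bchi := Lip_bmf Ox0 c_ge0 c_le c_part lc.
have bpr (h : T -> R) : bmf Om h -> bmf D (fun s => h (pr s)).
  move=> [mh [B hB]]; split; last by exists B => s Ds; exact/hB/prD.
  apply: (measurable_comp mOm) => //.
  by move=> _ [s Ds <-]; exact: prD.
(* Each of the two approximations costs [e' * fine (mu Om)]; the added 1 keeps [K] positive for a
   null measure. *)
pose K := 2 * (fine (mu Om) + 1).
have mu0 : 0 <= fine (mu Om) by exact: fine_ge0.
have K0 : 0 < K by rewrite mulr_gt0// ltr_wpDl.
have [//|I [g [r [mg Or cr]]]] := @c_part (e / K); first exact: divr_gt0.
set e' := e / K in cr.
have e'0 : 0 < e' by exact: divr_gt0.
have chir x : Om x -> `|chi x - chi (r (g x))| <= e'.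
  by move=> Ox; apply: lc => // y Oy; exact: cr.
have mg' i : measurable (D `&` (g \o pr) @^-1` [set i]).
  have -> : D `&` (g \o pr) @^-1` [set i] =
      D `&` pr @^-1` (Om `&` g @^-1` [set i]).
    by apply/seteqP; split => s /= [Ds gs]; split => //;
      [split => //; exact: prD|case: gs].
  exact: mpr.
have sumE : \int[m]_(s in D) (chi (r (g (pr s))) * u s) =
    \int[mu]_(x in Om) chi (r (g x)).
  rewrite (@Rintegral_part _ _ _ m D u I (g \o pr) mD mg' iu (fun i => chi (r
    i))).
  have i1 : mu.-integrable Om (EFin \o (fun=> 1)).
    by apply: bmf_integrable => //; exact: bmf_cst.
  have -> : \int[mu]_(x in Om) chi (r (g x)) =
      \int[mu]_(x in Om) (chi (r (g x)) * (fun=> 1) x).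
    by apply: eq_Rintegral => x _; rewrite mulr1.
  rewrite (@Rintegral_part _ _ _ mu Om (fun=> 1) I g mOm mg i1 (fun i => chi (r
    i))).
  apply: eq_bigr => i _; congr (_ * _).
  rewrite Rintegral_cst// mul1r /Rintegral; congr fine.
  rewrite -mu_pr//; congr (integral _ _ _).
  by apply/seteqP; split => s /= [Ds gs]; split => //;
    [split => //; exact: prD|case: gs].
have iu1 : \int[m]_(s in D) u s = fine (mu Om).
  rewrite /Rintegral; congr fine; rewrite -[RHS]mu_pr//; congr (integral _ _ _).
  by apply/seteqP; split => s /= => [Ds|[]//]; split => //; exact: prD.
have brg : bmf Om (fun x => chi (r (g x))).
  exact: (@bmf_part _ _ _ Om I g mg (fun i => chi (r i))).
have d1 : `|\int[m]_(s in D) (chi (pr s) * u s) -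
    \int[m]_(s in D) (chi (r (g (pr s))) * u s)| <= e' * fine (mu Om).
  have i1 := integrable_bmfM mD iu (bpr _ bchi).
  have i2 := integrable_bmfM mD iu (bpr _ brg).
  rewrite -RintegralB//.
  have bd : bmf D (fun s => chi (pr s) - chi (r (g (pr s)))).
    exact: (bmfB (bpr _ bchi) (bpr _ brg)).
  rewrite -iu1 -RintegralZl//.
  under eq_Rintegral do rewrite -mulrBl.
  apply: le_trans (le_normr_Rintegral _ _) _ => //; first exact: integrable_bmfM.
  apply: le_Rintegral => //.
  - have -> : EFin \o (fun s => `|(chi (pr s) - chi (r (g (pr s)))) * u s|) =
        (abse \o (EFin \o (fun s => (chi (pr s) - chi (r (g (pr s)))) * u s))).
      by apply: funext.
    by apply: integrable_abse; exact: integrable_bmfM.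
  - by apply: integrable_bmfM => //; exact: bmf_cst.
  - by move=> s Ds; rewrite normrM (ger0_norm (u_ge0 Ds)) ler_wpM2r ?u_ge0//
    chir//; exact: prD.
have d2 : `|\int[mu]_(x in Om) chi x -
    \int[mu]_(x in Om) chi (r (g x))| <= e' * fine (mu Om).
  rewrite -(bintB mOm mu_fin)// ler_norml.
  have bd : bmf Om (fun x => chi x - chi (r (g x))) by apply: bmfB.
  rewrite -mulNr -!(bint_cst mOm mu); apply/andP; split.
    apply: bint_le => //; first exact: bmf_cst.
    by move=> x Ox; have := chir _ Ox; rewrite ler_norml => /andP[].
  apply: bint_le => //; first exact: bmf_cst.
  by move=> x Ox; have := chir _ Ox; rewrite ler_norml => /andP[].
have eK : 2 * (e' * fine (mu Om)) + 2 * e' = e.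
  have : e' * K = e by rewrite /e' mulfVK// gt_eqF.
  by rewrite /K; lra.
by move: d1 d2; rewrite sumE !ler_norml => /andP[? ?] /andP[? ?]; apply/andP;
  split; lra.
Qed.

End transfer.

(** * Transport plans *)

Section full_measure.
Context {d : measure_display} {T : measurableType d} {R : realType}.
Variables (P : {measure set T -> \bar R}) (E : set T).
Hypothesis mE : measurable E.
Hypothesis PE : P (~` E) = 0%E.

Lemma full_setI B : measurable B -> P (B `&` E) = P B.
Proof.
move=> mB; rewrite (measureDI P mB mE).
rewrite (@subset_measure0 _ _ _ P (B `\` E) (~` E)) ?add0e//.
- exact: measurableD.
- exact: measurableC.
Qed.

Lemma full_integral (h : T -> R) : measurable_fun setT h -> (forall x, 0 <= h
  x) ->
  (\int[P]_x (h x)%:E = \int[P]_(x in E) (h x)%:E)%E.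
Proof.
move=> mh h0; rewrite (@ge0_negligible_integral _ _ _ P setT (~` E))//.
- by rewrite setTD setCK.
- exact: measurableC.
- exact/measurable_EFinP.
- by move=> x _; rewrite lee_fin.
Qed.

End full_measure.

Lemma probability_full {d : measure_display} {T : measurableType d} {R : realType}
    (P : probability T R) (E : set T) :
  measurable E -> P E = 1%E -> P (~` E) = 0%E.
Proof. by move=> mE PE; rewrite probability_setC// PE subee. Qed.

Lemma probability_bint_cst {d : measure_display} {T : measurableType d}
    {R : realType} (P : probability T R) (E : set T) (a : R) :
  measurable E -> P E = 1%E -> \int[P]_(x in E) (fun=> a) x = a.
Proof.
move=> mE PE; transitivity (a * fine (P E)); first exact: bint_cst.
by rewrite PE mulr1.
Qed.

Section plans.
Context {d : measure_display} {T : measurableType d} {R : realType}.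
Variables (Om : set T) (c : T -> T -> R) (M : R) (x0 : T).
Hypothesis mOm : measurable Om.
Hypothesis Ox0 : Om x0.
Hypothesis c_sym : forall x y, c x y = c y x.
Hypothesis c_ge0 : forall x y, 0 <= c x y.
Hypothesis c_le : forall x y, Om x -> Om y -> c x y <= M.
Hypothesis c_part : forall e : R, 0 < e ->
  exists (I : finType) (g : T -> I) (r : I -> T),
  [/\ forall i, measurable (Om `&` g @^-1` [set i]), forall i, Om (r i) &
      forall x y, Om x -> Om y -> `|c x y - c (r (g x)) y| <= e].
Hypothesis mc : measurable_fun setT (fun z : T * T => c z.1 z.2).
Variables mu nu : probability T R.
Hypothesis mu1 : mu Om = 1%E.
Hypothesis nu1 : nu Om = 1%E.

(** On tuples this is convertible to [is_plan], so the main proof passes plans across unchanged. *)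
Definition plan (gam : probability (T * T)%type R) : Prop :=
  forall A : set T, measurable A ->
    gam (A `*` setT) = mu A /\ gam (setT `*` A) = nu A.

Let Om2 : set (T * T) := Om `*` Om.

Let mOm2 : measurable Om2. Proof. exact: measurableX. Qed.

Let bmf_c : bmf Om2 (fun z => c z.1 z.2).
Proof.
split; first exact: measurable_funTS.
by exists M => -[x y] [Ox Oy]; rewrite ger0_norm// c_le.
Qed.

Lemma plan_full gam : plan gam -> gam (~` Om2) = 0%E.
Proof.
move=> pg; have mC := measurableC mOm.
have h1 : gam (~` Om `*` setT) = 0%E.
  by have [-> _] := pg _ mC; exact: probability_full.
have h2 : gam (setT `*` ~` Om) = 0%E.
  by have [_ ->] := pg _ mC; exact: probability_full.
apply: (@subset_measure0 _ _ _ gam _ ((~` Om `*` setT) `|` (setT `*` ~` Om))).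
- exact: measurableC.
- by apply: measurableU; apply: measurableX.
- move=> -[x y] /=; have [Ox|Ox] := pselect (Om x); last by left.
  by move=> h; right; split => //= Oy; apply: h.
- apply/eqP; rewrite -measure_le0; apply: le_trans (measureU2 _ _ _) _.
  + by apply: measurableX.
  + by apply: measurableX.
  + by rewrite /= h1 h2 adde0.
Qed.

(** Weak duality: the pointwise bound [chi x + ct chi y <= c x y] is integrated over the plan.
    [Lip_transfer], with a projection as [pr] and weight 1, identifies the marginal integrals. *)
Lemma plan_ge gam chi : plan gam -> Lip Om c chi ->
  ((\int[mu]_(x in Om) chi x + \int[nu]_(y in Om) ct Om c chi y)%:E <=
   \int[gam]_z (c z.1 z.2)%:E)%E.
Proof.
move=> pg lc; have g0 := plan_full pg.
have gfin : (gam Om2 < +oo)%E.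
  by rewrite (le_lt_trans (probability_le1 _ _))// ltry.
rewrite (full_integral mOm2 g0)// -(EFin_bint mOm2 gfin)// lee_fin.
have lct := ct_Lip Ox0 c_sym c_ge0 c_le lc.
have i1 : gam.-integrable Om2 (EFin \o (fun=> 1)).
  by apply: bmf_integrable => //; exact: bmf_cst.
have mufin : (mu Om < +oo)%E by rewrite mu1 ltry.
have nufin : (nu Om < +oo)%E by rewrite nu1 ltry.
have E1 : \int[mu]_(x in Om) chi x = \int[gam]_(z in Om2) chi z.1.
  rewrite -(@Lip_transfer _ _ _ _ _ Om c M x0 mOm Ox0 c_ge0 c_le c_part
    mu gam mufin Om2 fst (fun=> 1))//.
  - by apply: eq_Rintegral => z _; rewrite mulr1.
  - by move=> z [].
  - exact: measurable_funTS.
  - move=> A mA AO; rewrite integral_cst//; last first.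
      by apply: measurableI => //; rewrite -[X in measurable X]setTI;
        exact: measurable_fst.
    rewrite mul1e setIC (full_setI mOm2 g0); last first.
      by rewrite -[X in measurable X]setTI; exact: measurable_fst.
    transitivity (gam (A `*` setT)); last by case: (pg _ mA).
    by congr (gam _); apply/seteqP; split => -[x y] /= => [?|[]].
have E2 : \int[nu]_(x in Om) ct Om c chi x = \int[gam]_(z in Om2) ct Om c chi z.2.
  rewrite -(@Lip_transfer _ _ _ _ _ Om c M x0 mOm Ox0 c_ge0 c_le c_part
    nu gam nufin Om2 snd (fun=> 1))//.
  - by apply: eq_Rintegral => z _; rewrite mulr1.
  - by move=> z [].
  - exact: measurable_funTS.
  - move=> A mA AO; rewrite integral_cst//; last first.
      by apply: measurableI => //; rewrite -[X in measurable X]setTI;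
        exact: measurable_snd.
    rewrite mul1e setIC (full_setI mOm2 g0); last first.
      by rewrite -[X in measurable X]setTI; exact: measurable_snd.
    transitivity (gam (setT `*` A)); last by case: (pg _ mA).
    by congr (gam _); apply/seteqP; split => -[x y] /= => [?|[]].
have bpr (h : T -> R) (pr : T * T -> T) : measurable_fun setT pr ->
    (forall z, Om2 z -> Om (pr z)) -> Lip Om c h -> bmf Om2 (fun z => h (pr z)).
  move=> mp pO lh; have [mh [B hB]] := Lip_bmf Ox0 c_ge0 c_le c_part lh.
  split; last by exists B => z Oz; exact/hB/pO.
  apply: (measurable_comp mOm) => //; last exact: measurable_funTS.
  by move=> _ [z Oz <-]; exact: pO.
have b1 : bmf Om2 (fun z => chi z.1).
  by apply: (bpr _ fst) => // z [].
have b2 : bmf Om2 (fun z => ct Om c chi z.2).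
  by apply: (bpr _ snd) => // z [].
rewrite E1 E2 -(bintD mOm2 gfin)//; apply: bint_le => //; first exact: bmfD.
move=> [x y] [Ox Oy] /=; have := ct_le Ox0 c_ge0 c_le y lc Ox; lra.
Qed.

Section approximate_plan.
Variable V : R.
Hypothesis V_ge : forall chi, Lip Om c chi ->
  \int[mu]_(x in Om) chi x + \int[nu]_(y in Om) ct Om c chi y <= V.

(* Discrete potentials [a, b] extend to the pair [(chi, chi^c)] with
   [chi x = min_j c (r j) x - b j], at the price of the mesh size. *)
Lemma discrete_dual_le (e : R) (I : finType) (g : T -> I) (r : I -> T) (a b : I
  -> R) :
  (forall i, measurable (Om `&` g @^-1` [set i])) -> (forall i, Om (r i)) ->
  (forall x y, Om x -> Om y -> `|c x y - c (r (g x)) y| <= e) ->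
  (forall i j, a i + b j <= c (r i) (r j)) ->
  \int[mu]_(x in Om) a (g x) + \int[nu]_(y in Om) b (g y) <= V + 2 * e.
Proof.
move=> mg Or cr ab.
pose chi x := inf [set c (r j) x - b j | j in [set: I]].
have hi x : has_inf [set c (r j) x - b j | j in [set: I]].
  split; first by exists (c (r (g x0)) x - b (g x0)), (g x0).
  exists (- \sum_j `|b j|) => _ [j _ <-]; rewrite lerNl opprB.
  rewrite (@le_trans _ _ (b j))//; first by rewrite gerBl.
  rewrite (bigD1 j)//= (le_trans (ler_norm _))// lerDl.
  exact: sumr_ge0.
have chi_le x j : chi x <= c (r j) x - b j.
  by apply: ge_inf; [have [] := hi x|exists j].
have chi_ge x v : (forall j, v <= c (r j) x - b j) -> v <= chi x.
  by move=> h; apply: lb_le_inf; [have [] := hi x|move=> _ [j _ <-]; exact: h].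
have lchi : Lip Om c chi.
  move=> x x' e' Ox Ox' H; rewrite ler_norml; apply/andP; split.
    rewrite lerBrDr addrC; apply: chi_ge => j; have := chi_le x' j.
    by have := H _ (Or j); rewrite !(c_sym (r j)) ler_norml => /andP[]; lra.
  rewrite lerBlDr -lerBlDl; apply: chi_ge => j; have := chi_le x j.
  by have := H _ (Or j); rewrite !(c_sym (r j)) ler_norml => /andP[]; lra.
have mufin : (mu Om < +oo)%E by rewrite mu1 ltry.
have nufin : (nu Om < +oo)%E by rewrite nu1 ltry.
have bchi := Lip_bmf Ox0 c_ge0 c_le c_part lchi.
have bct := Lip_bmf Ox0 c_ge0 c_le c_part (ct_Lip Ox0 c_sym c_ge0 c_le lchi).
have h1 : \int[mu]_(x in Om) a (g x) <= \int[mu]_(x in Om) chi x + e.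
  rewrite -[X in _ <= _ + X](probability_bint_cst _ mOm mu1).
  rewrite -(bintD mOm mufin)//; last exact: bmf_cst.
  apply: bint_le => //; [exact: bmf_part|by apply: bmfD => //; exact: bmf_cst|].
  move=> x Ox; rewrite -lerBlDr; apply: chi_ge => j.
  have := ab (g x) j; have := cr _ _ Ox (Or j).
  by rewrite (c_sym (r j) x) ler_norml => /andP[]; lra.
have h2 : \int[nu]_(y in Om) b (g y) <= \int[nu]_(y in Om) ct Om c chi y + e.
  rewrite -[X in _ <= _ + X](probability_bint_cst _ mOm nu1).
  rewrite -(bintD mOm nufin)//; last exact: bmf_cst.
  apply: bint_le => //; [exact: bmf_part|by apply: bmfD => //; exact: bmf_cst|].
  move=> y Oy; rewrite -lerBlDr; apply: (ct_ge Ox0) => x Ox.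
  have := chi_le x (g y); have := cr _ _ Oy Ox.
  by rewrite (c_sym y x) ler_norml => /andP[]; lra.
by have := V_ge lchi; lra.
Qed.

Lemma approximate_plan (e : R) : 0 < e ->
  exists2 gam, plan gam & (\int[gam]_z (c z.1 z.2)%:E <= (V + e)%:E)%E.
Proof.
(* Two quarters are lost in [discrete_dual_le] and two in replacing both arguments of the cost by
   representatives. *)
move=> e0; have e40 : 0 < e / 4 by rewrite divr_gt0.
have [I [g [r [mg Or cr]]]] := c_part e40.
set e4 := e / 4 in e40 cr.
pose A i := Om `&` g @^-1` [set i].
pose m i := fine (mu (A i)); pose n i := fine (nu (A i)).
have mA i : measurable (A i) by exact: mg.
have mE i : mu (A i) = (m i)%:E by rewrite fineK//; exact: fin_num_measure.
have nE i : nu (A i) = (n i)%:E by rewrite fineK//; exact: fin_num_measure.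
have m0 i : 0 <= m i by exact: fine_ge0.
have n0 i : 0 <= n i by exact: fine_ge0.
have mufin : (mu Om < +oo)%E by rewrite mu1 ltry.
have nufin : (nu Om < +oo)%E by rewrite nu1 ltry.
have partE (P : probability T R) (h : I -> R) : (P Om < +oo)%E ->
    \int[P]_(x in Om) h (g x) = \sum_i h i * fine (P (A i)).
  move=> Pfin; have i1 : P.-integrable Om (EFin \o (fun=> 1)).
    by apply: bmf_integrable => //; exact: bmf_cst.
  transitivity (\int[P]_(x in Om) (h (g x) * (fun=> 1) x)).
    by apply: eq_Rintegral => x _; rewrite mulr1.
  rewrite (@Rintegral_part _ _ _ P Om (fun=> 1) I g mOm mg i1 h).
  by apply: eq_bigr => i _; rewrite Rintegral_cst// mul1r.
have m1 : \sum_i m i = 1.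
  rewrite -[RHS](etrans (esym (partE mu (fun=> 1) mufin))
    (probability_bint_cst 1 mOm mu1)).
  by apply: eq_bigr => i _; rewrite mul1r.
have n1 : \sum_i n i = 1.
  rewrite -[RHS](etrans (esym (partE nu (fun=> 1) nufin))
    (probability_bint_cst 1 mOm nu1)).
  by apply: eq_bigr => i _; rewrite mul1r.
have [a b ab|w [w0 wm wn wV]] := @transport_duality R I m n
    (fun i j => c (r i) (r j)) (V + 2 * e4) m0 n0 m1 n1.
  by rewrite -(partE mu)// -(partE nu)//; exact: discrete_dual_le.
have w_m0 i j : m i = 0 -> w i j = 0.
  move=> mi; apply/eqP; rewrite eq_le w0 andbT -mi -(wm i) (bigD1 j)//= lerDl.
  exact: sumr_ge0.
have w_n0 i j : n j = 0 -> w i j = 0.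
  move=> nj; apply/eqP; rewrite eq_le w0 andbT -nj -(wn j) (bigD1 i)//= lerDl.
  exact: sumr_ge0.
(* Density, on the cell [(i, j)], of the glued plan with respect to the product of [mu] and [nu].
   Division by zero gives 0, which is right: [w i j] vanishes whenever [m i] or [n j] does. *)
pose q (ij : I * I) := w ij.1 ij.2 / (m ij.1 * n ij.2).
have q0 ij : 0 <= q ij by rewrite divr_ge0// mulr_ge0.
have qmn i j : q (i, j) * (m i * n j) = w i j.
  rewrite /q/=; have [mi|mi] := eqVneq (m i) 0;
    first by rewrite mi mul0r mulr0 w_m0.
  have [nj|nj] := eqVneq (n j) 0; first by rewrite nj !mulr0 w_n0.
  by rewrite mulfVK// mulf_neq0.
pose AA (ij : I * I) := A ij.1 `*` A ij.2.
have mAA ij : measurable (AA ij) by exact: measurableX.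
pose W (z : T * T) := \sum_ij q ij * \1_(AA ij) z.
have mt ij : measurable_fun setT (fun z : T * T => q ij * \1_(AA ij) z).
  by apply: measurable_funM => //; exact: measurable_indic.
have mW : measurable_fun setT W by exact: measurable_sum.
have W0 z : 0 <= W z by apply: sumr_ge0 => ij _; rewrite mulr_ge0.
have WE B : measurable B -> (\int[mu \x nu]_(z in B) (W z)%:E =
    \sum_ij (q ij)%:E * (mu \x nu) (AA ij `&` B))%E.
  move=> mB; under eq_integral do rewrite /W -sumEFin.
  rewrite ge0_integral_sum//.
  - apply: eq_bigr => ij _; under eq_integral do rewrite EFinM.
    rewrite ge0_integralZl_EFin//.
    + by rewrite integral_indic.
    + by apply/measurable_EFinP; exact: measurable_indic.
  - by move=> ij; apply/measurable_EFinP; exact: measurable_funTS.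
  - by move=> ij z _; rewrite lee_fin mulr_ge0.
(* The weights are known to be 1 only on cells of positive mass, since the row and column sums of
   [q] can be normalized only there; null cells contribute nothing. *)
have partB (P : probability T R) (v : I -> R) (B : set T) : P Om = 1%E ->
    (forall i, fine (P (A i)) != 0 -> v i = 1) -> measurable B ->
    \sum_i v i * fine (P (A i `&` B)) = fine (P B).
  move=> P1 v1 mB; have mD := measurableI _ _ mOm mB.
  have Dfin : (P (Om `&` B) < +oo)%E.
    by rewrite (le_lt_trans (probability_le1 _ _))// ltry.
  have i1 : P.-integrable (Om `&` B) (EFin \o (fun=> 1)).
    by apply: bmf_integrable => //; exact: bmf_cst.
  have AB i : Om `&` B `&` g @^-1` [set i] = A i `&` B by rewrite setIAC.
  have mgB i : measurable (Om `&` B `&` g @^-1` [set i]).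
    by rewrite AB; exact: measurableI.
  have := @Rintegral_part _ _ _ P (Om `&` B) (fun=> 1) I g mD mgB i1 (fun=> 1).
  have PB : P (Om `&` B) = P B.
    by rewrite setIC; exact: full_setI mOm (probability_full mOm P1) _ mB.
  rewrite !mul1r => E; rewrite -PB.
  transitivity (1 * fine (P (Om `&` B))); last by rewrite mul1r.
  rewrite -[RHS](Rintegral_cst P mD) E.
  apply: eq_bigr => i _; rewrite AB Rintegral_cst//; last exact: measurableI.
  rewrite !mul1r; have [Pi|/v1 ->] := eqVneq (fine (P (A i))) 0;
    last by rewrite mul1r.
  have P0 : P (A i `&` B) = 0%E.
    apply: (@subset_measure0 _ _ _ P _ (A i)) => //; first exact: measurableI.
    by rewrite -[LHS]fineK ?fin_num_measure// Pi.
  transitivity (v i * fine 0%E); first by congr (_ * fine _).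
  by rewrite mulr0; apply: esym; exact: (congr1 fine P0).
have fm (P : probability T R) i B : measurable B ->
    P (A i `&` B) = (fine (P (A i `&` B)))%:E.
  by move=> mB; rewrite fineK//; apply: fin_num_measure; exact: measurableI.
have prodE B B' : measurable B -> measurable B' ->
    ((mu \x nu) (B `*` B') = mu B * nu B')%E.
  by move=> mB mB'; exact: product_measure1E.
have marg1 B : measurable B -> (\int[mu \x nu]_(z in B `*` setT) (W z)%:E = mu
  B)%E.
  move=> mB; rewrite WE; last exact: measurableX.
  transitivity (\sum_i \sum_j (q (i, j) * (fine (mu (A i `&` B)) * n j))%:E)%E.
    rewrite pair_big/=; apply: eq_bigr => -[i j] _ /=.
    rewrite /AA/= -setXI setIT prodE//; last exact: measurableI.
    by rewrite nE fm// -!EFinM.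
  under eq_bigr do rewrite sumEFin.
  rewrite sumEFin -[RHS]fineK ?fin_num_measure//; congr EFin.
  rewrite -(partB mu (fun i => \sum_j q (i, j) * n j) B mu1)//.
    apply: eq_bigr => i _; rewrite mulr_suml; apply: eq_bigr => j _.
    by rewrite (mulrC (fine _)) mulrA.
  move=> i; rewrite -/(m i) => mi; apply: (mulfI mi); rewrite mulr1 -{2}wm.
  by rewrite mulr_sumr; apply: eq_bigr => j _; rewrite mulrCA qmn.
have marg2 B : measurable B -> (\int[mu \x nu]_(z in setT `*` B) (W z)%:E = nu
  B)%E.
  move=> mB; rewrite WE; last exact: measurableX.
  transitivity (\sum_j \sum_i (q (i, j) * (m i * fine (nu (A j `&` B))))%:E)%E.
    rewrite exchange_big pair_big/=; apply: eq_bigr => -[i j] _ /=.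
    rewrite /AA/= -setXI setIT prodE//; last exact: measurableI.
    by rewrite mE fm// -!EFinM.
  under eq_bigr do rewrite sumEFin.
  rewrite sumEFin -[RHS]fineK ?fin_num_measure//; congr EFin.
  rewrite -(partB nu (fun j => \sum_i q (i, j) * m i) B nu1)//.
    apply: eq_bigr => j _; rewrite mulr_suml; apply: eq_bigr => i _.
    by rewrite mulrA.
  move=> j; rewrite -/(n j) => nj; apply: (mulfI nj); rewrite mulr1 -{2}wn.
  by rewrite mulr_sumr; apply: eq_bigr => i _; rewrite mulrCA (mulrC (n j)) qmn.
have [//|gam gamE] := @density_probability _ _ _ (mu \x nu)%E W mW W0.
  by rewrite -setXTT marg1// probability_setT.
have pg : plan gam by move=> B mB; rewrite !gamE marg1// marg2.
exists gam => //; have g0 := plan_full pg.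
have gfin : (gam Om2 < +oo)%E.
  by rewrite (le_lt_trans (probability_le1 _ _))// ltry.
rewrite (full_integral mOm2 g0)// -(EFin_bint mOm2 gfin)// lee_fin.
pose G (z : T * T) := (g z.1, g z.2).
have GAA ij : Om2 `&` G @^-1` [set ij] = AA ij.
  case: ij => i j; apply/seteqP; split => -[x y] /=.
    by move=> [[Ox Oy] [gx gy]].
  by move=> [[Ox gx] [Oy gy]]; split => //; congr (_, _).
have mG ij : measurable (Om2 `&` G @^-1` [set ij]).
  by rewrite GAA; exact: mAA.
have i1 : gam.-integrable Om2 (EFin \o (fun=> 1)).
  by apply: bmf_integrable => //; exact: bmf_cst.
pose h (ij : I * I) := c (r ij.1) (r ij.2) + 2 * e4.
apply: (@le_trans _ _ (\int[gam]_(z in Om2) (h (G z) * (fun=> 1) z))).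
  apply: bint_le => //.
    by apply: bmfM; [exact: (@bmf_part _ _ _ _ _ G mG h)|exact: bmf_cst].
  move=> [x y] [Ox Oy] /=; rewrite mulr1 /h/=.
  have := cr _ _ Ox Oy; have := cr _ _ Oy (Or (g x)).
  rewrite (c_sym y) (c_sym (r (g y))) !ler_norml => /andP[? ?] /andP[? ?].
  by lra.
rewrite (@Rintegral_part _ _ _ gam Om2 (fun=> 1) _ G mOm2 mG i1 h).
have gAA i j : gam (Om2 `&` G @^-1` [set (i, j)]) = (w i j)%:E.
  rewrite GAA gamE WE// (bigD1 (i, j))//= big1 ?adde0.
    by rewrite setIid prodE// mE nE -!EFinM qmn.
  move=> [k l] kl; suff -> : AA (k, l) `&` AA (i, j) = set0.
    by rewrite measure0 mule0.
  apply/seteqP; split => // -[x y] [[[_ gx] [_ gy]] [[_ gx'] [_ gy']]] /=.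
  by move/eqP: kl; apply; congr (_, _); [exact: etrans (esym gx) gx'|exact:
    etrans (esym gy) gy'].
have -> : \sum_ij h ij * \int[gam]_(s in Om2 `&` G @^-1` [set ij]) (fun=> 1) s =
    \sum_i \sum_j w i j * c (r i) (r j) + 2 * e4 * \sum_i \sum_j w i j.
  rewrite mulr_sumr -big_split/=.
  under [RHS]eq_bigr do rewrite mulr_sumr -big_split/=.
  rewrite pair_big/=; apply: eq_bigr => -[i j] _ /=.
  have -> : \int[gam]_(s in Om2 `&` G @^-1` [set (i, j)]) (fun=> 1) s = w i j.
    transitivity (1 * fine (gam (Om2 `&` G @^-1` [set (i, j)]))).
      exact: Rintegral_cst.
    by rewrite gAA mul1r.
  by rewrite /h/=; ring.
have -> : \sum_i \sum_j w i j = 1 by under eq_bigr do rewrite wm.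
have : e4 * 4 = e by rewrite /e4 mulfVK.
by move: wV; lra.
Qed.

End approximate_plan.
End plans.

(** * Lebesgue measure and the cost on tuples *)

Section lebn_succ.
Variables (R : realType) (n : nat).
Variable m : {sigma_finite_measure set (n.-tuple R) -> \bar R}.

Let consT (q : measurableTypeR R * n.-tuple R) : n.+1.-tuple R :=
  cons_tuple q.1 q.2.

Let unconsT (x : n.+1.-tuple R) : measurableTypeR R * n.-tuple R :=
  (thead x, [tuple of behead x]).

Let mconsT : measurable_fun setT consT.
Proof. exact: (measurable_cons measurable_fst measurable_snd). Qed.

Let unconsTK : cancel consT unconsT.
Proof.
by move=> [a x]; rewrite /unconsT /consT theadE; congr pair; exact: val_inj.
Qed.

Let munconsT : measurable_fun setT unconsT.
Proof.
apply: measurable_fun_pair; first exact: measurable_tnth.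
exact: measurable_behead.
Qed.

Let mpre A : measurable A -> measurable (consT @^-1` A).
Proof. by move=> mA; rewrite -[X in measurable X]setTI; exact: mconsT. Qed.

(** The recursive clause of [lebn], with an arbitrary sigma-finite [m] in place of the
    lower-dimensional measure, so that a measure structure can be attached to it. *)
Definition lebn_succ : set (n.+1.-tuple R) -> \bar R :=
  fun A => ((@lebesgue_measure R) \x m)%E (consT @^-1` A).

Let lebn_succ0 : lebn_succ set0 = 0%E.
Proof. by rewrite /lebn_succ preimage_set0 measure0. Qed.

Let lebn_succ_ge0 A : (0 <= lebn_succ A)%E.
Proof. exact: measure_ge0. Qed.

Let lebn_succ_sigma_additive : semi_sigma_additive lebn_succ.
Proof.
move=> F mF tF mUF; rewrite /lebn_succ preimage_bigcup.
apply: measure_semi_sigma_additive.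
- by move=> i; exact: mpre.
- apply/trivIsetP => i j _ _ ij; rewrite -preimage_setI.
  by move/trivIsetP : tF => /(_ _ _ _ _ ij) ->//; rewrite preimage_set0.
- by rewrite -preimage_bigcup; exact: mpre.
Qed.

HB.instance Definition _ := isMeasure.Build _ _ _ lebn_succ
  lebn_succ0 lebn_succ_ge0 lebn_succ_sigma_additive.

Let lebn_succ_sigma_finite : sigma_finite setT lebn_succ.
Proof.
have /sigma_finiteP[F [FT ndF Ffin]] := sigma_finiteT (@lebesgue_measure R).
have /sigma_finiteP[G [GT ndG Gfin]] := sigma_finiteT m.
(* Both exhaustions are nondecreasing, so their diagonal products cover: the index [maxn i j] serves
   both factors. *)
exists (fun i => unconsT @^-1` (F i `*` G i)).
  apply/seteqP; split => // x _.
  have : [set: R] (thead x) by []. rewrite FT => -[i _ Fi].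
  have : [set: n.-tuple R] [tuple of behead x] by []. rewrite GT => -[j _ Gj].
  exists (maxn i j) => //; split => /=.
    by move: (thead x) Fi; exact/subsetPset/ndF/leq_maxl.
  by move: [tuple of behead x] Gj; exact/subsetPset/ndG/leq_maxr.
move=> i; have [mFi Fi] := Ffin i; have [mGi Gi] := Gfin i; split.
  by rewrite -[X in measurable X]setTI; apply: munconsT => //; exact: measurableX.
rewrite /lebn_succ -comp_preimage (_ : unconsT \o consT = id); last first.
  by apply: funext => q /=; exact: unconsTK.
by rewrite preimage_id product_measure1E// lte_mul_pinfty// ge0_fin_numE.
Qed.

HB.instance Definition _ := Measure_isSigmaFinite.Build _ _ _ lebn_succ
  lebn_succ_sigma_finite.

Lemma lebn_succ_measure :
  exists m' : {sigma_finite_measure set (n.+1.-tuple R) -> \bar R},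
    (m' : set (n.+1.-tuple R) -> \bar R) = lebn_succ.
Proof. by exists lebn_succ. Qed.

End lebn_succ.

(** [lebn] is a bare set function, so measure theory reaches it through a bundled measure equal to
    it. Sigma-finiteness is carried through the induction because the next product requires it. *)
Lemma lebn_measure (R : realType) (n : nat) :
  exists m : {sigma_finite_measure set (n.-tuple R) -> \bar R},
    (m : set (n.-tuple R) -> \bar R) = @lebn R n.
Proof.
elim: n => [|n [m mE]]; first by exists (dirac [tuple]).
have [m' m'E] := lebn_succ_measure m; exists m'; rewrite m'E /lebn_succ/=.
by rewrite mE.
Qed.

(** * Boxes, measurability of closed sets, and volume *)

Section boxes.
Variables (R : realType) (n : nat).
Implicit Types (x y a : n.-tuple R) (A : set (n.-tuple R)).

(** An open ball of the sup norm: unlike a Euclidean ball, it is a product of intervals. *)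
Definition box x (r : R) : set (n.-tuple R) :=
  [set y | forall i, `|tnth x i - tnth y i| < r].

Lemma edist_coord x y i : `|tnth x i - tnth y i| <= Defs.edist x y.
Proof.
rewrite /Defs.edist -sqrtr_sqr ler_wsqrtr// (bigD1 i)//= lerDl.
by apply: sumr_ge0 => j _; exact: sqr_ge0.
Qed.

(** The factor [n.+1], cruder than the square root of [n], keeps the bound positive and strict also
    for [n = 0]. *)
Lemma box_edist x y r : 0 < r -> box x r y -> Defs.edist x y < n.+1%:R * r.
Proof.
move=> r0 xy; have K0 : 0 < n.+1%:R * r by rewrite mulr_gt0.
rewrite -[ltRHS]gtr0_norm// -sqrtr_sqr /Defs.edist ltr_sqrt ?exprn_gt0//.
apply: (@le_lt_trans _ _ (n%:R * r ^+ 2)).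
  rewrite -[n in leRHS]card_ord mulr_natl -sumr_const; apply: ler_sum => i _.
  by rewrite -(real_normK (num_real _)) lerXn2r ?nnegrE ?(ltW r0)// ltW// xy.
rewrite exprMn ltr_pM2r ?exprn_gt0//.
by rewrite -natrX ltr_nat (@leq_trans (n.+1 ^ 1))// leq_pexp2l.
Qed.

Lemma measurable_box x r : measurable (box x r).
Proof.
have -> : box x r = \bigcap_(i in [set: 'I_n])
    ((fun y => tnth y i) @^-1` `]tnth x i - r, tnth x i + r[%classic).
  apply/seteqP; split => y /= h i; last first.
    have := h i I; rewrite /= in_itv/= => /andP[h1 h2].
    by rewrite ltr_norml; apply/andP; split; lra.
  by move=> _; rewrite /= in_itv/=; have := h i;
    rewrite ltr_norml => /andP[h1 h2];
    apply/andP; split; lra.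
apply: fin_bigcap_measurable => // i _; rewrite -[X in measurable X]setTI.
exact: measurable_tnth.
Qed.

(** An open set is the union of the boxes with rational centre and radius that it contains, and
    these are countably many. *)
Lemma box_open_measurable A :
  (forall x, A x -> exists2 r, 0 < r & box x r `<=` A) -> measurable A.
Proof.
move=> oA.
pose ctr (q : n.-tuple rat) : n.-tuple R := [tuple ratr (tnth q i) | i < n].
pose F (qs : n.-tuple rat * rat) :=
  if `[< box (ctr qs.1) (ratr qs.2) `<=` A >] then box (ctr qs.1) (ratr qs.2)
  else set0.
suff -> : A = \bigcup_qs F qs.
  apply: countable_bigcupT_measurable; first exact: countableP.
  by move=> qs; rewrite /F; case: ifP => _ //; exact: measurable_box.
apply/seteqP; split => [x Ax|x [qs _]]; last first.
  by rewrite /F; case: ifPn => // /asboolP h; exact: h.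
have [r r0 rA] := oA _ Ax.
(* A box of radius below [r / 2] whose centre lies within that radius of [x] stays inside
   [box x r]. *)
have r20 : 0 < r / 2 by rewrite divr_gt0.
have [s] := rat_in_itvoo r20; rewrite in_itv/= => /andP[s0 sr].
have ex i : exists q : rat, `|tnth x i - ratr q| < ratr s.
  have h : tnth x i - ratr s < tnth x i + ratr s by lra.
  have [q] := rat_in_itvoo h; rewrite in_itv/= => /andP[h1 h2].
  by exists q; rewrite ltr_norml; apply/andP; split; lra.
have [q hq] := choice ex.
exists ([tuple q i | i < n], s) => //; rewrite /F/=; case: ifPn => [_|].
  by move=> i; rewrite /ctr !tnth_mktuple distrC.
move=> /asboolP[] y /= hy; apply: rA => i.
have := hy i; have := hq i; rewrite /ctr !tnth_mktuple !ltr_norml.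
by move=> /andP[? ?] /andP[? ?]; apply/andP; split; lra.
Qed.

Lemma measurable_eclosure A : measurable (eclosure A).
Proof.
rewrite -[X in measurable X]setCK; apply: measurableC.
apply: box_open_measurable => x /existsNP[e /not_implyP[e0 /forallNP h]].
(* If [y] is in [box x r] and [z] within [r] of [y], then [z] is in the box of radius [r * 2] around
   [x], hence at distance below [e]. *)
pose r := e / n.+1%:R / 2; have r0 : 0 < r by rewrite !divr_gt0.
exists r => // y xy /(_ _ r0)[z [Az yz]]; apply: (h z); split => //.
have -> : e = n.+1%:R * (r * 2) by rewrite /r; field.
apply: box_edist; first by rewrite mulr_gt0.
move=> i; have := xy i; have := le_lt_trans (edist_coord y z i) yz.
by rewrite !ltr_norml => /andP[? ?] /andP[? ?]; apply/andP; split; lra.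
Qed.

End boxes.

(** Serves to show that [Om], squeezed between two boxes, has positive finite measure. *)
Lemma lebn_box (R : realType) (n : nat) (x : n.-tuple R) (r : R) : 0 <= r ->
  @lebn R n (box x r) = ((r *+ 2) ^+ n)%:E.
Proof.
move=> r0; elim: n x => [|n IH] x.
  rewrite /= expr0 indicE mem_set//.
  by case.
rewrite /=; have [m mE] := lebn_measure R n; rewrite -mE.
have -> : (fun q : R * n.-tuple R => cons_tuple q.1 q.2) @^-1` box x r =
    ball (thead x) r `*` box [tuple of behead x] r.
  apply/seteqP; split => -[a y] /=.
    move=> h; split; first by have := h ord0; rewrite tnth0.
    move=> i; have := h (lift ord0 i); rewrite tnthS; congr (`|_ - _| < _).
    by rewrite [in LHS](tuple_eta x) tnthS.
  move=> [h0 h] i; case: (unliftP ord0 i) => [j|] ->.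
    have := h j; rewrite tnthS; congr (`|_ - _| < _).
    by rewrite [in RHS](tuple_eta x) tnthS.
  by rewrite tnth0.
rewrite product_measure1E; last 2 first.
- exact: measurable_ball.
- exact: measurable_box.
rewrite [X in (X * _)%E](_ : _ = (r *+ 2)%:E); last exact: lebesgue_measure_ball.
by rewrite [X in (_ * X)%E](_ : _ = @lebn R n (box [tuple of behead x] r)) ?mE//
  IH -EFinM exprS.
Qed.

(** * Uniform regularity of the cost on bounded sets *)

Section cost_regularity.
Variables (R : realType) (n : nat) (p : R).
Hypothesis p1 : 1 <= p.
Implicit Types (x y : n.-tuple R).

Lemma edist_ge0 x y : 0 <= Defs.edist x y.
Proof. exact: sqrtr_ge0. Qed.

Lemma edist_sym x y : Defs.edist x y = Defs.edist y x.
Proof.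
rewrite /Defs.edist; congr Num.sqrt; apply: eq_bigr => i _.
by rewrite -sqrrN opprB.
Qed.

Lemma cost_sym x y : cost p x y = cost p y x.
Proof. by rewrite /cost edist_sym. Qed.

Lemma cost_ge0 x y : 0 <= cost p x y.
Proof. exact: powR_ge0. Qed.

Lemma cost_diag x : cost p x x = 0.
Proof.
rewrite /cost /Defs.edist big1 => [|i _]; last by rewrite subrr expr0n.
by rewrite sqrtr0 powR0// gt_eqF// (lt_le_trans _ p1).
Qed.

Lemma measurable_cost :
  measurable_fun setT (fun z : n.-tuple R * n.-tuple R => cost p z.1 z.2).
Proof.
apply: (@measurableT_comp _ _ _ _ _ _ (@powR R ^~ p));
  first exact: measurable_powR.
rewrite /Defs.edist; apply: (@measurableT_comp _ _ _ _ _ _ (@Num.sqrt R)).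
  by apply: continuous_measurable_fun; exact: sqrt_continuous.
apply: measurable_sum => i; apply: measurable_funX; apply: measurable_funB.
  by apply: (measurableT_comp (measurable_tnth i)).
by apply: (measurableT_comp (measurable_tnth i)).
Qed.

(* Convexity bounds the slope between [b] and [a] by the one towards [B + 1]. *)
Lemma powR_lip (B a b : R) : 0 <= b -> b <= a -> a <= B ->
  a `^ p - b `^ p <= (B + 1) `^ p * (a - b).
Proof.
move=> b0 ba aB; have B1 : 1 <= B + 1 - b by lra.
pose t := (a - b) / (B + 1 - b).
have t0 : 0 <= t by rewrite divr_ge0 ?subr_ge0//; lra.
have t1 : t <= 1 by rewrite ler_pdivrMr; lra.
have tB : t * (B + 1 - b) = a - b by rewrite mulfVK// gt_eqF//; lra.
have tab : t <= a - b by rewrite -tB ler_peMr.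
have := @convex_powR R p p1 (Itv01 t0 t1) (B + 1) b.
rewrite !inE/= !in_itv/= !andbT => /(_ _ b0) h.
have {}h : a `^ p <= t * (B + 1) `^ p + (1 - t) * b `^ p.
  have -> : a = t * (B + 1) + (1 - t) * b by move: tB; lra.
  by apply: h; lra.
have : 0 <= t * b `^ p by rewrite mulr_ge0// powR_ge0.
have : t * (B + 1) `^ p <= (a - b) * (B + 1) `^ p.
  by rewrite ler_wpM2r// powR_ge0.
by move: h; lra.
Qed.

(** Subadditivity of the square root; it converts closeness of the sums of squares into closeness of
    Euclidean distances. *)
Lemma sqrt_dist (s s' : R) : 0 <= s -> 0 <= s' ->
  `|Num.sqrt s - Num.sqrt s'| <= Num.sqrt `|s - s'|.
Proof.
wlog ss : s s' / s' <= s.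
  move=> h s0 s'0; have [ss|/ltW ss] := leP s' s; first exact: h.
  by rewrite distrC (distrC s); exact: h.
move=> s0 s'0; rewrite !ger0_norm ?subr_ge0 ?ler_wsqrtr// lerBlDl.
have a0 := sqrtr_ge0 s'; have b0 := sqrtr_ge0 (s - s').
rewrite -(ler_pXn2r (_ : (0 < 2)%N)) ?nnegrE ?sqrtr_ge0 ?addr_ge0//.
rewrite sqrrD !sqr_sqrtr ?subr_ge0//.
have : 0 <= Num.sqrt s' * Num.sqrt (s - s') by rewrite mulr_ge0.
by rewrite -mulr_natr; lra.
Qed.

Lemma cost_modulus (Om : set (n.-tuple R)) (M e : R) : 0 < e ->
  (forall x y, Om x -> Om y -> Defs.edist x y <= M) ->
  exists2 r, 0 < r & forall x x' y, Om x -> Om x' -> Om y -> box x r x' ->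
    `|cost p x y - cost p x' y| <= e.
Proof.
move=> e0 OM; have [[z Oz]|/forallNP noOm] := pselect (exists z, Om z);
  last first.
  by exists 1 => // x x' y /noOm.
have M0 : 0 <= M by rewrite (le_trans (edist_ge0 z z))// OM.
(* [K] is a Lipschitz constant of the power on [[0, M]], and a box of radius [r] changes the sum of
   squares by at most [r * L]. So [r * L = (e / K) ^+ 2] gives [e / K] for the distance and [e] for
   the cost; the added 1s ensure positivity. *)
pose K := (M + 1) `^ p + 1.
have K0 : 0 < K by rewrite ltr_wpDl// powR_ge0.
pose L := n%:R * (2 * M) + 1.
have L0 : 0 < L by rewrite ltr_wpDl// mulr_ge0// mulr_ge0.
pose r := (e / K) ^+ 2 / L.
have r0 : 0 < r by rewrite divr_gt0// exprn_gt0// divr_gt0.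
exists r => // x x' y Ox Ox' Oy xx'.
pose s w := \sum_(i < n) (tnth w i - tnth y i) ^+ 2.
have s0 w : 0 <= s w by apply: sumr_ge0 => i _; exact: sqr_ge0.
have ds : `|s x - s x'| <= (e / K) ^+ 2.
  have -> : (e / K) ^+ 2 = r * L by rewrite /r mulfVK// gt_eqF.
  rewrite /s -sumrB (le_trans (ler_norm_sum _ _ _))//.
  apply: (@le_trans _ _ (\sum_(i < n) r * (2 * M))).
    apply: ler_sum => i _; rewrite subr_sqr normrM.
    have -> : tnth x i - tnth y i - (tnth x' i - tnth y i) = tnth x i - tnth x' i.
      by ring.
    rewrite ler_pM//; first exact: ltW (xx' i).
    have h1 := le_trans (edist_coord x y i) (OM _ _ Ox Oy).
    have h2 := le_trans (edist_coord x' y i) (OM _ _ Ox' Oy).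
    by rewrite (le_trans (ler_normD _ _))//; lra.
  rewrite sumr_const card_ord -mulr_natl /L.
  have := ltW r0; lra.
have de : `|Defs.edist x y - Defs.edist x' y| <= e / K.
  rewrite (le_trans (sqrt_dist (s0 x) (s0 x')))//.
  rewrite -[leRHS]ger0_norm; last by rewrite divr_ge0 ?ltW.
  by rewrite -[leRHS]sqrtr_sqr ler_wsqrtr.
have main a b : Om a -> Om b -> Defs.edist b y <= Defs.edist a y ->
    `|Defs.edist a y - Defs.edist b y| <= e / K -> `|cost p a y - cost p b y|
      <= e.
  move=> Oa Ob ba hab.
  rewrite ger0_norm ?subr_ge0; last first.
    by rewrite ge0_ler_powR ?nnegrE ?edist_ge0// (le_trans _ p1).
  rewrite (le_trans (powR_lip (edist_ge0 _ _) ba (OM _ _ Oa Oy)))//.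
  rewrite ger0_norm ?subr_ge0// in hab.
  apply: (@le_trans _ _ (K * (e / K))); last by rewrite mulrC mulfVK// gt_eqF.
  rewrite ler_pM ?powR_ge0 ?subr_ge0//.
  by rewrite /K lerDl.
have [h|/ltW h] := leP (Defs.edist x' y) (Defs.edist x y); first exact: main.
by rewrite distrC; apply: main => //; rewrite distrC.
Qed.

Lemma cost_partition (Om : set (n.-tuple R)) (x0 : n.-tuple R) (M e : R) :
  measurable Om -> Om x0 -> 0 < e ->
  (forall x y, Om x -> Om y -> Defs.edist x y <= M) ->
  exists (I : finType) (g : n.-tuple R -> I) (r : I -> n.-tuple R),
  [/\ forall i, measurable (Om `&` g @^-1` [set i]), forall i, Om (r i) &
      forall x y, Om x -> Om y -> `|cost p x y - cost p (r (g x)) y| <= e].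
Proof.
move=> mOm Ox0 e0 OM; have [del del0 hdel] := cost_modulus e0 OM.
(* The [i]-th coordinate relative to [x0], shifted by [M] to be nonnegative on [Om] and measured in
   units of [del]; its integer part labels the grid cell. *)
pose t x i := (tnth x i - tnth x0 i + M) / del.
have tb x i : Om x -> 0 <= t x i <= 2 * M / del.
  move=> Ox; have := le_trans (edist_coord x x0 i) (OM _ _ Ox Ox0).
  rewrite ler_norml => /andP[h1 h2]; apply/andP; split.
    by rewrite divr_ge0 ?(ltW del0)//; lra.
  by rewrite ler_pM2r ?invr_gt0//; lra.
pose N := Num.truncn (2 * M / del).
pose g x : {ffun 'I_n -> 'I_N.+1} := [ffun i => inord (Num.truncn (t x i))].
have gE x i : Om x -> g x i = Num.truncn (t x i) :> nat.
  move=> Ox; rewrite ffunE inordK// ltnS /N truncn_ge_nat.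
    have /andP[h1 h2] := tb x i Ox; rewrite (le_trans _ h2)//.
    by rewrite truncn_le.
  by have /andP[h1 h2] := tb x i Ox; rewrite (le_trans h1).
(* Some point of [Om] in the cell [j]; cells that miss [Om] get [x0], so every representative lies
   in [Om]. *)
pose r (j : {ffun 'I_n -> 'I_N.+1}) : n.-tuple R :=
  if pselect (exists2 x, Om x & g x = j) is left h then projT1 (cid2 h) else x0.
have Or j : Om (r j).
  by rewrite /r; case: pselect => [h|//]; case: (cid2 h).
have gr x : Om x -> g (r (g x)) = g x.
  move=> Ox; rewrite /r; case: pselect => [h|[]]; last by exists x.
  by case: (cid2 h).
exists _, g, r; split => // [j|x y Ox Oy].
  have -> : Om `&` g @^-1` [set j] = Om `&` \bigcap_(i in [set: 'I_n])
      ((fun x => tnth x i) @^-1`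
        `[(j i)%:R * del + tnth x0 i - M, (j i).+1%:R * del + tnth x0 i -
          M[%classic).
    have key x i : Om x -> (Num.truncn (t x i) == j i :> nat) =
        ((j i)%:R * del + tnth x0 i - M <= tnth x i <
         (j i).+1%:R * del + tnth x0 i - M).
      move=> Ox; have /andP[h1 _] := tb x i Ox.
      rewrite truncn_eq// /t ler_pdivlMr// ltr_pdivrMr//.
      move: ((j i)%:R * del) ((j i).+1%:R * del) => u v.
      by congr andb; apply/idP/idP; lra.
    apply/seteqP; split => x [Ox h]; split => //.
      by move=> i _ /=; rewrite in_itv/= -key// -gE// h.
    apply/ffunP => i; apply/val_inj => /=; rewrite gE//; apply/eqP.
    by rewrite key//; have := h i I; rewrite /= in_itv.
  apply: measurableI => //; apply: fin_bigcap_measurable => // i _.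
  by rewrite -[X in measurable X]setTI; exact: measurable_tnth.
apply: hdel => // i.
have tt : Num.truncn (t (r (g x)) i) = Num.truncn (t x i).
  by rewrite -!gE// gr.
have /andP[h1 _] := tb x i Ox; have /andP[h2 _] := tb _ i (Or (g x)).
have /andP[] := truncn_itv h1; have /andP[] := truncn_itv h2; rewrite tt.
rewrite -natr1 => a1 a2 a3 a4.
have : `|t x i - t (r (g x)) i| < 1 by rewrite ltr_norml; apply/andP; split; lra.
have -> : t x i - t (r (g x)) i = (tnth x i - tnth (r (g x)) i) / del.
  by rewrite /t -mulrBl; congr (_ / _); ring.
by rewrite normrM normfV (gtr0_norm del0) ltr_pdivrMr// mul1r.
Qed.

End cost_regularity.

(** * The optimal density *)

Section optimum.
Context {d : measure_display} {T : measurableType d} {R : realType}.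
Variables (Om : set T) (c : T -> T -> R) (M : R) (x0 : T).
Hypothesis mOm : measurable Om.
Hypothesis Ox0 : Om x0.
Hypothesis c_sym : forall x y, c x y = c y x.
Hypothesis c_ge0 : forall x y, 0 <= c x y.
Hypothesis c_diag : forall x, c x x = 0.
Hypothesis c_le : forall x y, Om x -> Om y -> c x y <= M.
Hypothesis c_part : forall e : R, 0 < e ->
  exists (I : finType) (g : T -> I) (r : I -> T),
  [/\ forall i, measurable (Om `&` g @^-1` [set i]), forall i, Om (r i) &
      forall x y, Om x -> Om y -> `|c x y - c (r (g x)) y| <= e].
Variable lam : {measure set T -> \bar R}.
Hypothesis lam_gt0 : (0 < lam Om)%E.
Hypothesis lam_fin : (lam Om < +oo)%E.
Variables f df k : R -> R.
Hypothesis f_ge0 : forall x : R, 0 <= x -> 0 <= f x.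
Hypothesis f_cvx : forall x y t : R, 0 <= x -> 0 <= y -> x != y ->
  0 < t -> t < 1 -> f (t * x + (1 - t) * y) < t * f x + (1 - t) * f y.
Hypothesis f_drv : forall x : R, 0 < x -> is_derive x 1 f (df x).
Hypothesis f0 : f 0 = 0.
Hypothesis df0 : df 0 = 0.
Hypothesis kP : forall t : R, 0 <= t -> 0 <= k t /\ df (k t) = t.
Hypothesis kK : forall x : R, 0 <= x -> k (df x) = x.

Let H := conj_f f k.
Let kpk := kp k.

Let kpk_continuous : continuous kpk.
Proof. exact: (kp_continuous f_ge0 f_cvx f_drv f0 df0 kP kK). Qed.

Let H_continuous : continuous H.
Proof. exact: (conj_f_continuous f_ge0 f_cvx f_drv f0 df0 kP kK). Qed.

Let kpk_ge0 s : 0 <= kpk s. Proof. exact: (kp_ge0 kP). Qed.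

(** The extension by 0 makes this a density on the whole space whose measure is concentrated on
    [Om]. *)
Definition density_of (psi : T -> R) (x : T) : R :=
  if x \in Om then kpk (- psi x) else 0.

Lemma density_of_ge0 psi x : 0 <= density_of psi x.
Proof. by rewrite /density_of; case: ifP. Qed.

Lemma density_ofE psi x : Om x -> density_of psi x = kpk (- psi x).
Proof. by move=> Ox; rewrite /density_of mem_set. Qed.

Let lip_bmf chi : Lip Om c chi -> bmf Om chi.
Proof. exact: Lip_bmf Ox0 c_ge0 c_le c_part _. Qed.

Lemma bmf_density_of psi : Lip Om c psi -> bmf Om (fun x => kpk (- psi x)).
Proof. by move=> lp; apply: bmf_comp => //; exact/bmfN/lip_bmf. Qed.

Lemma measurable_density_of psi : Lip Om c psi ->
  measurable_fun setT (density_of psi).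
Proof.
move=> lp; have [mk _] := bmf_density_of lp.
have -> : density_of psi = (fun x => kpk (- psi x)) \_ Om.
  by apply: funext => x; rewrite patchE.
by apply/(measurable_restrictT _ mOm).
Qed.

Lemma integral_density_of psi A : Lip Om c psi -> measurable A ->
  (\int[lam]_(x in A) (density_of psi x)%:E =
   \int[lam]_(x in A `&` Om) (kpk (- psi x))%:E)%E.
Proof.
move=> lp mA; rewrite integral_mkcondr; apply: eq_integral => x _.
by rewrite /density_of patchE; case: ifP.
Qed.

Lemma optimal_density (nu : probability T R) : nu Om = 1%E ->
  exists (psi : T -> R) (mu : probability T R), [/\ Lip Om c psi,
    exists2 phi, Lip Om c phi & psi = ct Om c phi,
    (forall x, Om x -> psi x <= 0),
    (forall A, mu A = \int[lam]_(x in A) (density_of psi x)%:E)%E &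
    forall chi, Lip Om c chi ->
      \int[mu]_(x in Om) chi x + \int[nu]_(y in Om) ct Om c chi y <=
      \int[mu]_(x in Om) psi x + \int[nu]_(y in Om) ct Om c psi y].
Proof.
move=> nu1; have nufin : (nu Om < +oo)%E by rewrite nu1 ltry.
have H_sub s s' : H s' - H s <= kpk s' * (s' - s).
  exact: conj_f_sub f_ge0 f_cvx f_drv f0 df0 kP kK _ _.
have H_ge0 s : 0 <= H s by exact: (conj_f_ge0 f_ge0 f_cvx f_drv f0 df0 kP kK).
have H_le0 s : s <= 0 -> H s = 0 by exact: (conj_f_le0 f0 df0 kK).
have H_coercive t : 0 <= t -> exists C, forall s, s * t - C <= H s.
  by move=> t0; exists (f t) => s; exact: (fenchel f_ge0 f_cvx f_drv f0 df0 kP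
    kK).
have H_homo : {homo H : s s' / s <= s'}.
  exact: (conj_f_homo f_ge0 f_cvx f_drv f0 df0 kP kK).
have kpk_homo : {homo kpk : s s' / s <= s'}.
  exact: (kp_homo f_ge0 f_cvx f_drv f0 df0 kP kK).
have [psi [lpsi psic psi0 psiM]] := @dual_cconcave_max _ _ _ Om c M x0 mOm Ox0
  c_sym c_ge0 c_diag c_le c_part lam nu lam_gt0 lam_fin nu1 H kpk H_sub H_ge0
  H_le0 H_coercive H_continuous H_homo kpk_ge0 kpk_homo.
have var chi := @dual_variation _ _ _ Om c M x0 mOm Ox0
  c_sym c_ge0 c_le c_part lam nu lam_fin nu1 H kpk H_sub
  H_continuous kpk_ge0 kpk_homo kpk_continuous psi lpsi psiM chi.
have bk := bmf_density_of lpsi.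
have bpsi := lip_bmf lpsi.
have bct := lip_bmf (ct_Lip Ox0 c_sym c_ge0 c_le lpsi).
have k1 : \int[lam]_(x in Om) kpk (- psi x) = 1.
  (* Adding [a] to [psi] subtracts [a] from its c-transform, so the variation inequality becomes [a]
     times mass minus one; [a = 1] and [a = -1] force mass one. *)
  have shift a : a * (\int[lam]_(x in Om) kpk (- psi x) - 1) <= 0.
    have := var _ (Lip_shift a lpsi).
    have -> : \int[nu]_(y in Om) ct Om c (fun x => psi x + a) y =
        \int[nu]_(y in Om) ct Om c psi y - a.
      rewrite -[X in _ = _ - X](probability_bint_cst a mOm nu1).
      rewrite -(bintB mOm nufin)//; last exact: bmf_cst.
      by apply: eq_Rintegral => y _; exact: (ct_shift Ox0 c_ge0 c_le).
    have -> : \int[lam]_(x in Om) (kpk (- psi x) * (psi x + a)) =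
        \int[lam]_(x in Om) (kpk (- psi x) * psi x) +
        a * \int[lam]_(x in Om) kpk (- psi x).
      rewrite -(bintZ mOm lam_fin)// -(bintD mOm lam_fin);
        [|exact: bmfM|exact: bmfZ].
      by apply: eq_Rintegral => x _; ring.
    by lra.
  by have := shift 1; have := shift (-1); lra.
have u1 : (\int[lam]_x (density_of psi x)%:E = 1)%E.
  rewrite integral_density_of// setTI -(EFin_bint mOm lam_fin)//.
  by rewrite k1.
have [mu muE] := density_probability (measurable_density_of lpsi)
  (@density_of_ge0 psi) u1.
exists psi, mu; split => // chi lchi.
have mufin : (mu Om < +oo)%E.
  by rewrite (le_lt_trans (probability_le1 _ _))// ltry.
(* With the identity as [pr], this turns the weighted integrals of the variation inequality into
   integrals against [mu]. *)
have tr phi : Lip Om c phi -> \int[mu]_(x in Om) phi x =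
    \int[lam]_(x in Om) (kpk (- psi x) * phi x).
  move=> lphi; rewrite -(@Lip_transfer _ _ _ _ _ Om c M x0 mOm Ox0 c_ge0 c_le
    c_part mu lam mufin Om id (fun x => kpk (- psi x)))//.
  - by apply: eq_Rintegral => x _; rewrite mulrC.
  - exact: bmf_integrable.
  - move=> A mA AO; rewrite preimage_id setIC -integral_density_of//.
    exact/esym/muE.
by rewrite !tr//; have := var _ lchi; lra.
Qed.

(** * Fenchel lower bound for the entropy and its equality case *)

Section entropy.
Variable psi : T -> R.
Hypothesis lpsi : Lip Om c psi.
Variable mu : probability T R.
Variable u : T -> R.
Hypothesis mu_ : measurable_fun setT u.
Hypothesis u_ge0 : forall x, 0 <= u x.
Hypothesis muE : forall A, measurable A -> mu A = (\int[lam]_(x in A) (u x)%:E)%E.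

Let iu : lam.-integrable Om (EFin \o u).
Proof.
apply/integrableP; split; first by apply/measurable_EFinP;
  exact: measurable_funTS.
under eq_integral do rewrite gee0_abs ?lee_fin//.
by rewrite -muE// (le_lt_trans (probability_le1 _ _))// ltry.
Qed.

Lemma measurable_entropy : measurable_fun Om (EFin \o (fun x => f (u x))).
Proof.
apply/measurable_EFinP.
have -> : (fun x => f (u x)) = (fun t : R => f (Num.max t 0)) \o u.
  by apply: funext => x /=; rewrite (max_idPl (u_ge0 x)).
apply: measurableT_comp; last exact: measurable_funTS.
apply: continuous_measurable_fun.
exact: (f_continuous f_ge0 f_cvx f_drv f0 df0).
Qed.

(** The Fenchel minorant of [f (u x)], reached exactly when [u x = kpk (- psi x)]. It is integrable
    even if the entropy is infinite, and its integral depends on [u] only through the integral of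
    [psi] against [mu]. *)
Let G x := - H (- psi x) - psi x * u x.

Let bH : bmf Om (fun x => H (- psi x)).
Proof. by apply: bmf_comp => //; exact/bmfN/lip_bmf. Qed.

Let iG : lam.-integrable Om (EFin \o G).
Proof.
have -> : EFin \o G = ((EFin \o (fun x => - H (- psi x))%R) \-
    (EFin \o (fun x => psi x * u x)%R))%E by apply: funext.
apply: integrableB => //.
  by apply: bmf_integrable => //; exact: bmfN.
by apply: integrable_bmfM => //; exact: lip_bmf.
Qed.

Let intG : (\int[lam]_(x in Om) (G x)%:E =
  (- (\int[lam]_(x in Om) H (- psi x)) - \int[mu]_(x in Om) psi x)%:E)%E.
Proof.
rewrite -[LHS]fineK; last exact: (integrable_fin_num mOm iG).
congr EFin; rewrite -[LHS]/(\int[lam]_(x in Om) G x) /G.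
have mufin : (mu Om < +oo)%E.
  by rewrite (le_lt_trans (probability_le1 _ _))// ltry.
have bN : bmf Om (fun x => - H (- psi x)) by exact: bmfN.
have i1 := bmf_integrable mOm lam_fin bN.
have i2 := integrable_bmfM mOm iu (lip_bmf lpsi).
rewrite RintegralB//; congr (_ - _).
  rewrite -mulN1r -(bintZ mOm lam_fin)//.
  by apply: eq_Rintegral => x _; rewrite mulN1r.
apply: (@Lip_transfer _ _ _ _ _ Om c M x0 mOm Ox0 c_ge0 c_le
    c_part mu lam mufin Om id u) => //.
by move=> A mA AO; rewrite preimage_id (setIidr AO) -muE.
Qed.

Let G_le x : G x <= f (u x).
Proof.
have := fenchel f_ge0 f_cvx f_drv f0 df0 kP kK (- psi x) (u_ge0 x).
by rewrite -/H /G; lra.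
Qed.

Lemma entropy_ge :
  ((- (\int[lam]_(x in Om) H (- psi x)) - \int[mu]_(x in Om) psi x)%:E <=
   \int[lam]_(x in Om) (f (u x))%:E)%E.
Proof.
rewrite -intG; have [->|fin] := eqVneq (\int[lam]_(x in Om) (f (u x))%:E)%E +oo%E.
  exact: leey.
apply: le_integral => //; last by move=> x _; rewrite lee_fin.
apply/integrableP; split; first exact: measurable_entropy.
under eq_integral do rewrite gee0_abs ?lee_fin ?f_ge0//.
by rewrite ltey.
Qed.

Lemma entropy_attained : (forall x, Om x -> u x = kpk (- psi x)) ->
  (\int[lam]_(x in Om) (f (u x))%:E =
   (- (\int[lam]_(x in Om) H (- psi x)) - \int[mu]_(x in Om) psi x)%:E)%E.
Proof.
move=> uk; rewrite -intG; apply: eq_integral => x /set_mem Ox.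
by rewrite /G uk// /H /conj_f -/kpk; congr EFin; ring.
Qed.

(** The excess [f (u x) - G x] is nonnegative with zero integral, hence zero almost everywhere, and
    strict Fenchel identifies [u] there. *)
Lemma entropy_eq :
  (\int[lam]_(x in Om) (f (u x))%:E <=
   (- (\int[lam]_(x in Om) H (- psi x)) - \int[mu]_(x in Om) psi x)%:E)%E ->
  mu Om = 1%E ->
  forall A, measurable A ->
  mu A = (\int[lam]_(x in A) (density_of psi x)%:E)%E.
Proof.
rewrite -intG => fG mu1 A mA.
have ifu : lam.-integrable Om (EFin \o (fun x => f (u x))).
  apply/integrableP; split; first exact: measurable_entropy.
  under eq_integral do rewrite gee0_abs ?lee_fin ?f_ge0//.
  by rewrite (le_lt_trans fG)// intG ltry.
pose ex x := f (u x) - G x.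
have mex : measurable_fun Om (EFin \o ex).
  apply/measurable_EFinP; apply: measurable_funB.
    exact/measurable_EFinP/measurable_entropy.
  by apply/measurable_EFinP; exact: measurable_int iG.
have ex0 : (\int[lam]_(x in Om) `|(EFin \o ex) x| = 0)%E.
  under eq_integral do rewrite /= ger0_norm ?subr_ge0//.
  apply/eqP; rewrite eq_le; apply/andP; split; last first.
    by apply: integral_ge0 => x _; rewrite lee_fin subr_ge0.
  under eq_integral do rewrite EFinB.
  rewrite integralB_EFin//; have Gfin := integrable_fin_num mOm iG.
  by rewrite sube_le0.
have [N [mN N0 sN]] := (ae_eq_integral_abs lam mOm mex).1 ex0.
have uE x : Om x -> ~ N x -> u x = kpk (- psi x).
  move=> Ox Nx; apply: contrapT => /eqP ux.
  have := fenchel_lt f_ge0 f_cvx f_drv f0 df0 kP kK (u_ge0 x) ux.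
  have : ex x = 0.
    have := contrapT (fun h => Nx (sN x h)) Ox.
    by move=> -[].
  by rewrite /ex /G -/H; lra.
have mAO := measurableI _ _ mA mOm.
transitivity (mu (A `&` Om)).
  exact: (esym (full_setI mOm (probability_full mOm mu1) mA)).
rewrite integral_density_of// muE//.
apply: ae_eq_integral => //.
- by apply/measurable_EFinP; exact: measurable_funTS.
- have [mk _] := bmf_density_of lpsi.
  by apply/measurable_EFinP; apply: measurable_funS mk => // x [].
- exists N; split => // x /= h; apply: contrapT => Nx; apply: h => -[_ Ox].
  by rewrite uE.
Qed.

Lemma entropy_density_eq (u' : T -> R) : measurable_fun setT u' -> (forall x, 0
  <= u' x) ->
  (forall A, measurable A -> mu A = \int[lam]_(x in A) (u' x)%:E)%E ->
  ae_eq lam Om (EFin \o u) (EFin \o u').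
Proof.
move=> mu' u'0 mu'E; apply: integral_ae_eq => //.
  by apply/measurable_EFinP; exact: measurable_funTS.
by move=> E EO mE; rewrite -mu'E// muE.
Qed.

End entropy.

(** Two densities of [mu] agree almost everywhere on [Om]. Thus the infimum defining [Fent] ranges
    over a single value, and a bound on it passes to any given density. *)
Lemma entropy_unique (mu : probability T R) (u u' : T -> R) :
  measurable_fun setT u -> (forall x, 0 <= u x) ->
  (forall A, measurable A -> mu A = \int[lam]_(x in A) (u x)%:E)%E ->
  measurable_fun setT u' -> (forall x, 0 <= u' x) ->
  (forall A, measurable A -> mu A = \int[lam]_(x in A) (u' x)%:E)%E ->
  (\int[lam]_(x in Om) (f (u x))%:E = \int[lam]_(x in Om) (f (u' x))%:E)%E.
Proof.
move=> mu_ u0 muE mu' u'0 mu'E.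
have [N [mN N0 sN]] := entropy_density_eq mu_ u0 muE mu' u'0 mu'E.
apply: ae_eq_integral => //; [exact: measurable_entropy|exact:
  measurable_entropy|].
exists N; split => // x /= h; apply: sN => /= h'; apply: h => Ox.
by have [->] := h' Ox.
Qed.

Lemma entropy_density_of psi (mu : probability T R) : Lip Om c psi ->
  (forall A, mu A = \int[lam]_(x in A) (density_of psi x)%:E)%E ->
  (\int[lam]_(x in Om) (f (density_of psi x))%:E =
  (- (\int[lam]_(x in Om) H (- psi x)) - \int[mu]_(x in Om) psi x)%:E)%E.
Proof.
move=> lpsi muE; apply: entropy_attained => //.
- exact: measurable_density_of.
- exact: density_of_ge0.
- by move=> x Ox; exact: density_ofE.
Qed.

End optimum.

(** * c-concave functions in extended-real form, and conclusion *)

Section potentials.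
Variables (R : realType) (n : nat) (p : R) (Om : set (n.-tuple R)).
Variable x0 : n.-tuple R.
Hypothesis Ox0 : Om x0.
Implicit Types (chi phi : n.-tuple R -> R).

Lemma ctrans_ct M chi y : (forall x y, Om x -> Om y -> cost p x y <= M) ->
  Lip Om (@cost R n p) chi ->
  ctrans p Om chi y = (ct Om (@cost R n p) chi y)%:E.
Proof.
move=> c_le lc; have [ne lb] := ct_has_inf Ox0 (@cost_ge0 R n p) c_le y lc.
rewrite /ct -ereal_inf_EFin// /ctrans; congr ereal_inf.
by rewrite image_comp; apply: eq_imagel => x _ /=; rewrite EFinB.
Qed.

(** Every c-concave competitor belongs to the class [Lip], so optimality within that class is
    optimality among all of them. The function [phi] behind [chi] is arbitrary; only finiteness of
    its transform on [Om] enters. *)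
Lemma c_concave_Lip chi : c_concave p Om chi -> Lip Om (@cost R n p) chi.
Proof.
move=> [phi phiE] y y' e Oy Oy' h.
have aux z z' : Om z -> Om z' -> (forall x, Om x -> `|cost p z x - cost p z' x|
  <= e) ->
    chi z - e <= chi z'.
  move=> Oz Oz' hz; rewrite -lee_fin -phiE//;
    apply: le_ereal_inf_tmp => _ [x Ox <-].
  have : ((chi z)%:E <= (cost p x z)%:E - (phi x)%:E)%E.
    by rewrite -phiE//; apply: ereal_inf_lbound; exists x.
  rewrite -!EFinB !lee_fin; have := hz _ Ox.
  by rewrite !(cost_sym p x) ler_norml => /andP[]; lra.
rewrite ler_norml; have h1 := aux _ _ Oy Oy' h.
have h2 : chi y' - e <= chi y by apply: aux => // x Ox; rewrite distrC h.
by apply/andP; split; lra.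
Qed.

End potentials.

Theorem theorem3p8 (R : realType) (n : nat) (Om : set (n.-tuple R))
  (f df k : R -> R) (p : R) (nu : probability (n.-tuple R) R) :
  bounded_domain Om ->
  (* standing assumptions on f : [0,+oo) -> [0,+oo) *)
  (forall x : R, 0 <= x -> 0 <= f x) ->
  (forall x y t : R, 0 <= x -> 0 <= y -> x != y -> 0 < t -> t < 1 ->
     f (t * x + (1 - t) * y) < t * f x + (1 - t) * f y) ->
  (* f is C^1 on [0,+oo) with derivative df (one-sided at 0) *)
  (forall x : R, 0 < x -> is_derive x 1 f (df x)) ->
  ((h^-1 * (f h - f 0) : R) @[h --> (0 : R)^'+] --> df 0) ->
  {within `[(0 : R), +oo[, continuous df} ->
  f 0 = 0 -> df 0 = 0 ->
  ((f x / x : R) @[x --> +oo] --> +oo) ->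
  (* k = (f')^{-1} : [0,+oo) -> [0,+oo) *)
  (forall t : R, 0 <= t -> 0 <= k t /\ df (k t) = t) ->
  (forall x : R, 0 <= x -> k (df x) = x) ->
  1 <= p ->
  in_PO Om nu ->
  exists mu : probability (n.-tuple R) R,
    [/\ in_PO Om mu,
        (forall mu' : probability (n.-tuple R) R,
           in_PO Om mu' -> (Ffrak f p Om nu mu <= Ffrak f p Om nu mu')%E),
        (forall mu' : probability (n.-tuple R) R, in_PO Om mu' ->
           (forall mu'' : probability (n.-tuple R) R,
              in_PO Om mu'' -> (Ffrak f p Om nu mu' <= Ffrak f p Om nu mu'')%E) ->
           forall A, measurable A -> mu' A = mu A) &
        exists u : n.-tuple R -> R,
          is_density mu u /\
          exists psi : n.-tuple R -> R,
            kantorovich_potential p Om mu nu psi /\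
            {ae @lebn R n, forall x, Om x -> 0 <= - psi x /\ u x = k (- psi x)}].
Proof.
move=> [[M OM] [U [oU [x0 Ox0'] _ OmE]] _] f_ge0 f_cvx f_drv _ _ f0 df0 _ kP kK
  p1 nu1.
have mOm : measurable Om by rewrite OmE; exact: measurable_eclosure.
have UOm : U `<=` Om.
  move=> x Ox; rewrite OmE => e e0; exists x; split => //.
  by rewrite /Defs.edist big1 ?sqrtr0// => i _; rewrite subrr expr0n.
have Ox0 := UOm _ Ox0'.
have M0 : 0 <= M by rewrite (le_trans (edist_ge0 x0 x0))// OM.
have [lam lamE] := lebn_measure R n.
have lam_fin : (lam Om < +oo)%E.
  (* The diameter bound [M] is enlarged by 1 because boxes are open. *)
  apply: (@le_lt_trans _ _ (lam (box x0 (M + 1)))).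
    apply: le_measure; rewrite ?inE//; first exact: measurable_box.
    move=> x Ox i; rewrite (le_lt_trans (edist_coord x0 x i))//.
    by rewrite (le_lt_trans (OM _ _ Ox0 Ox))// ltrDl.
  by rewrite lamE lebn_box ?ltry// addr_ge0.
have lam_gt0 : (0 < lam Om)%E.
  have [e e0 eU] := oU _ Ox0'; pose r := e / n.+1%:R.
  have r0 : 0 < r by rewrite divr_gt0.
  apply: (@lt_le_trans _ _ (lam (box x0 r))).
    by rewrite lamE lebn_box ?(ltW r0)// lte_fin exprn_gt0// pmulrn_lgt0.
  apply: le_measure; rewrite ?inE//; first exact: measurable_box.
  move=> x xr; apply/UOm/eU.
  have -> : e = n.+1%:R * r by rewrite /r mulrC mulfVK.
  exact: box_edist.
pose c := @cost R n p.
have c_le x y : Om x -> Om y -> c x y <= M `^ p.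
  by move=> Ox Oy; rewrite ge0_ler_powR ?nnegrE ?edist_ge0 ?OM// (le_trans _ p1).
have c_part e : 0 < e -> _ := fun e0 => cost_partition p1 mOm Ox0 e0 OM.
have c_sym := @cost_sym R n p.
have c_ge0 := @cost_ge0 R n p.
have mc := @measurable_cost R n p.
have [psi [mu [lpsi [phi lphi psiE] psi0 muE psiM]]] :=
  optimal_density mOm Ox0 c_sym c_ge0 (cost_diag p1) c_le c_part
    lam_gt0 lam_fin f_ge0 f_cvx f_drv f0 df0 kP kK nu1.
pose u := density_of Om k psi.
have mu_ : measurable_fun setT u.
  exact: (measurable_density_of mOm Ox0 c_ge0 c_le c_part f_ge0 f_cvx f_drv f0
    df0 kP kK lpsi).
have u0 x : 0 <= u x by exact: (density_of_ge0 Om kP).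
have du : is_density mu u by split => // A mA; rewrite -lamE.
have u_out : (\int[lam]_(x in ~` Om) (u x)%:E = 0)%E.
  apply: integral0_eq => x nOx; congr EFin.
  by rewrite /u /density_of memNset.
have mu1 : mu Om = 1%E.
  have := probability_setT mu; rewrite -(setUv Om) measureU//; last 2 first.
  - exact: measurableC.
  - exact: setICr.
  by rewrite [X in (_ + X)%E]muE u_out adde0.
have mufin : (mu Om < +oo)%E by rewrite mu1 ltry.
have nufin : (nu Om < +oo)%E by rewrite nu1 ltry.
set V := \int[mu]_(x in Om) psi x + \int[nu]_(y in Om) ct Om c psi y in psiM.
pose h := \int[lam]_(x in Om) conj_f f k (- psi x).
have Fu : (\int[lam]_(x in Om) (f (u x))%:E =
    (- h - \int[mu]_(x in Om) psi x)%:E)%E.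
  exact: (entropy_density_of mOm Ox0 c_ge0 c_le c_part lam_fin f_ge0 f_cvx
    f_drv f0 df0 kP kK).
have Tmu : (Tp p mu nu <= V%:E)%E.
  apply/lee_addgt0Pr => e e0.
  have [gam pg cg] := approximate_plan mOm Ox0 c_sym c_ge0 c_le c_part mc mu1
    nu1 psiM e0.
  by apply: ge_ereal_inf; eexists; [exists gam => //; exact: pg|exact: cg].
(* The right-hand side equals the integral of [ct Om c psi] against [nu] minus [h], which does not
   involve [mu]. The lower bounds [Tlow] and [Flow] add up to the same value for every
   competitor. *)
have upper : (Ffrak f p Om nu mu <= (V - h - \int[mu]_(x in Om) psi x)%:E)%E.
  rewrite -addrA EFinD; apply: leeD => //; rewrite -Fu lamE.
  by apply: ereal_inf_lbound; exists u.
have Tlow mu' : in_PO Om mu' ->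
    ((\int[mu']_(x in Om) psi x + \int[nu]_(y in Om) ct Om c psi y)%:E <=
     Tp p mu' nu)%E.
  move=> mu'1; apply: le_ereal_inf_tmp => _ [gam pg <-].
  exact: (plan_ge mOm Ox0 c_sym c_ge0 c_le c_part mc mu'1 nu1 pg lpsi).
have Flow mu' : in_PO Om mu' ->
    ((- h - \int[mu']_(x in Om) psi x)%:E <= Fent f Om mu')%E.
  move=> mu'1; apply: le_ereal_inf_tmp => _ [u' [mu'_ u'0 mu'E] <-];
    rewrite -lamE.
  apply: (entropy_ge mOm Ox0 c_ge0 c_le c_part lam_fin f_ge0 f_cvx f_drv f0 df0
    kP kK lpsi) => //.
  by move=> A mA; rewrite mu'E// -lamE.
exists mu; split => //.
- move=> mu' mu'1; apply: (le_trans upper).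
  apply: le_trans (leeD (Tlow _ mu'1) (Flow _ mu'1)).
  by rewrite -EFinD lee_fin /V; lra.
- move=> mu' mu'1 mu'min A mA; rewrite muE.
  have le := le_trans (mu'min _ mu1) upper.
  (* A minimizer has total at most the sum of the two lower bounds. Cancelling the finite bound on
     its transport cost leaves the equality case of the entropy bound. *)
  have Fle : (Fent f Om mu' <= (- h - \int[mu']_(x in Om) psi x)%:E)%E.
    set a := \int[mu']_(x in Om) psi x + \int[nu]_(y in Om) ct Om c psi y.
    rewrite -(@leeD2lE _ a%:E)//; apply: le_trans (leeD2r _ (Tlow _ mu'1)) _.
    by apply: (le_trans le); rewrite -EFinD lee_fin /V /a; lra.
  (* Finiteness of [Fent] provides a density, the infimum over no density being infinite. *)
  have [_ [u' du' _] _] := ereal_inf_lt (le_lt_trans Fle (ltry _)).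
  have [mu'_ u'0 mu'E] := du'.
  have mu'E' B : measurable B -> mu' B = (\int[lam]_(x in B) (u' x)%:E)%E.
    by move=> mB; rewrite mu'E// -lamE.
  apply: (entropy_eq mOm Ox0 c_ge0 c_le c_part lam_fin f_ge0 f_cvx f_drv f0 df0
    kP kK lpsi mu'_ u'0 mu'E' _ mu'1 mA).
  apply: le_trans Fle; apply: le_ereal_inf_tmp => _ [u2 [mu2 u20 mu2E] <-].
  rewrite -lamE (entropy_unique mOm f_ge0 f_cvx f_drv f0 df0 mu'_ u'0 mu'E' mu2
    u20)//.
  by move=> B mB; rewrite mu2E// -lamE.
- exists u; split => //; exists psi; split; last first.
    rewrite -lamE; apply: aeW => x Ox; split; first by rewrite oppr_ge0 psi0.
    by rewrite /u density_ofE// kp_nneg// oppr_ge0 psi0.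
  split; first by exists phi => y Oy; rewrite psiE (ctrans_ct Ox0 _ c_le lphi).
  have obj chi : Lip Om c chi -> kant_obj p Om mu nu chi =
      (\int[mu]_(x in Om) chi x + \int[nu]_(y in Om) ct Om c chi y)%:E.
    move=> lchi; rewrite /kant_obj EFinD; congr (_ + _)%E.
      rewrite (EFin_bint mOm mufin)//; exact: (Lip_bmf Ox0 c_ge0 c_le c_part).
    under eq_integral do rewrite (ctrans_ct Ox0 _ c_le lchi).
    rewrite (EFin_bint mOm nufin)//.
    exact/(Lip_bmf Ox0 c_ge0 c_le c_part)/(ct_Lip Ox0 c_sym c_ge0 c_le).
  move=> chi /c_concave_Lip lchi.
  by rewrite !obj// lee_fin psiM.
Qed.
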